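(* Let $K$ be an infinite commutative domain and let $R$ be an associative (not necessarily unital) $K$-algebra on which $K$ acts torsion-freely. Then the following statements are equivalent. (i) $R$ satisfies a circle semigroup identity; (ii) $R$ satisfies a reduced semigroup identity; (iii) $R$ satisfies a reduced binomial identity; (iv) there exist $n\ge 0$ and $\alpha_0,\dots,\alpha_n\in K$ with $\alpha_0\neq 0$ and $\alpha_n\neq 0$ such that $\sum_{i=0}^n \alpha_i y^i x y^{n-i}=0$ for all $x,y\in R$; (v) $R$ satisfies an Engel identity, i.e. there is $n\ge 1$ with $e_n(x,y)=0$ for all $x,y\in R$; (vi) $(R,\circ)$ satisfies a Morse identity, i.e. there is $n\ge1$ with $u_n(x,y)=v_n(x,y)$ for all $x,y\in(R,\circ)$.
   Context: All identities are nontrivial. Let $X=\{x=x_1,y=x_2,x_3,\dots\}$. A semigroup $S$ satisfies an identity $u=v$, where $u\ne v$ are words in the free semigroup on $X$, if $u$ and $v$ take equal values in $S$ under every substitution of elements of $S$ for the variables. The identity is left reduced if the first letters of $u,v$ differ, right reduced if the last letters differ, and reduced if both. $(R,\cdot)$ is the multiplicative semigroup of $R$; $(R,\circ)$ is $R$ with the operation $x\circ y=x+y+xy$. ''$R$ satisfies a (reduced) semigroup identity'' refers to $(R,\cdot)$; ''circle semigroup identity'' refers to $(R,\circ)$. A binomial identity is a nontrivial polynomial identity $\alpha_1u_1+\alpha_2u_2=0$ with $u_1,u_2$ monomials (words in $X$) and $\alpha_1,\alpha_2\in K$; it is reduced if the first letters of $u_1,u_2$ differ and the last letters differ. $[a,b]=ab-ba$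 and $e_n=[x,y,\dots,y]$ (left-normed, $y$ repeated $n$ times), i.e. $e_1=[x,y]$, $e_{n+1}=[e_n,y]$. Define $f_1(x,y)=xy$, $g_1(x,y)=yx$, $f_{n+1}=f_n\,x_{n+2}\,g_n$, $g_{n+1}=g_n\,x_{n+2}\,f_n$ (with $f_n,g_n$ in variables $x,y,x_3,\dots,x_{n+1}$); the $n$th Morse identity $u_n(x,y)=v_n(x,y)$ is $f_n=g_n$ with $x_3=\dots=x_{n+1}$ replaced by the empty word (identity). *)

(* Defs.v *)
From HB Require Import structures.
From mathcomp Require Import all_boot all_order all_algebra.
Set Implicit Arguments. Unset Strict Implicit. Unset Printing Implicit Defensive.
Import Order.TTheory GRing.Theory Num.Theory.
Local Open Scope ring_scope.

(* Words of the free semigroup on X = {x_1, x_2, ...} are nonempty [seq nat];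
   the letter [k] stands for x_(k+1): x = 0, y = 1, x_3 = 2, ... *)

(* Value of a word under the substitution [f] in a semigroup with operation [op].
   (The empty word, which is not a semigroup word, gets a dummy value.) *)
Definition weval (T : Type) (op : T -> T -> T) (f : nat -> T) (w : seq nat) : T :=
  match w with
  | [::] => f 0%N
  | a :: s => foldl (fun t i => op t (f i)) (f a) s
  end.

Definition sg_identity (T : Type) (op : T -> T -> T) (u v : seq nat) : Prop :=
  [/\ u != [::], v != [::], u != v &
      forall f : nat -> T, weval op f u = weval op f v].

Definition reduced_words (u v : seq nat) : bool :=
  (head 0%N u != head 0%N v) && (last 0%N u != last 0%N v).

Definition satisfies_sg_identity (T : Type) (op : T -> T -> T) : Prop :=
  exists u v, sg_identity op u v.

Definition satisfies_reduced_sg_identity (T : Type) (op : T -> T -> T) : Prop :=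
  exists u v, reduced_words u v /\ sg_identity op u v.

Definition nu_algebra (K : comNzRingType) (V : lmodType K) (mul : V -> V -> V) : Prop :=
  [/\ associative mul, left_distributive mul +%R, right_distributive mul +%R,
      (forall (a : K) (x y : V), mul (a *: x) y = a *: mul x y) &
      (forall (a : K) (x y : V), mul x (a *: y) = a *: mul x y)].

Definition torsion_free (K : comNzRingType) (V : lmodType K) : Prop :=
  forall (a : K) (x : V), a *: x = 0 -> a = 0 \/ x = 0.

Definition infinite_type (T : eqType) : Prop := forall s : seq T, exists x, x \notin s.

Definition circ (K : comNzRingType) (V : lmodType K) (mul : V -> V -> V) (x y : V) : V :=
  x + y + mul x y.

(* reduced binomial identity a1 u1 + a2 u2 = 0 (nontrivial: (a1,a2) <> (0,0),
   which, as u1 <> u2, means the polynomial is nonzero) *)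
Definition satisfies_reduced_binomial_identity (K : comNzRingType) (V : lmodType K)
    (mul : V -> V -> V) : Prop :=
  exists (a1 a2 : K) (u1 u2 : seq nat),
    [/\ u1 != [::], u2 != [::], reduced_words u1 u2, (a1 != 0) || (a2 != 0) &
        forall f : nat -> V, a1 *: weval mul f u1 + a2 *: weval mul f u2 = 0].

Definition xyeval (T : Type) (op : T -> T -> T) (x y : T) (w : seq nat) : T :=
  weval op (fun k => if k == 0%N then x else y) w.

Definition yxy_word (i n : nat) : seq nat := nseq i 1%N ++ 0%N :: nseq (n - i) 1%N.

Definition lie_comm (K : comNzRingType) (V : lmodType K) (mul : V -> V -> V) (a b : V) : V :=
  mul a b - mul b a.

Definition engel (K : comNzRingType) (V : lmodType K) (mul : V -> V -> V) (n : nat) (x y : V) : V :=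
  iter n (fun z => lie_comm mul z y) x.

(* morse_fg n = (f_(n+1), g_(n+1)), with x_(k+1) encoded as letter k *)
Fixpoint morse_fg (n : nat) : seq nat * seq nat :=
  match n with
  | 0 => ([:: 0; 1]%N, [:: 1; 0]%N)
  | m.+1 => let: (f, g) := morse_fg m in (f ++ m.+2 :: g, g ++ m.+2 :: f)
  end.

(* u_n, v_n: delete x_3, ..., x_(n+1) (letters >= 2) from f_n, g_n;  n >= 1 *)
Definition morse_u (n : nat) : seq nat := [seq k <- (morse_fg n.-1).1 | (k < 2)%N].
Definition morse_v (n : nat) : seq nat := [seq k <- (morse_fg n.-1).2 | (k < 2)%N].

(* Main.v *)
(* Throughout, u * v - v * u is written ad v u, and R is embedded in its unitization.

   (i) => (ii): substituting c x_i for x_i turns a circle identity into an identity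
   between products of 1 + x_i X over R[X]; factors with constant term 1 can be
   cancelled, and the top coefficients give a reduced identity.
   (iii) => (iv): linearize at y.
   (iv) => (v): K[s, t] acts on R, s and t being left and right multiplication by y.
   Let p(s, t) be the form in (iv). Replacing y by c y + y^2 gives p(c s + s^2, c t + t^2) = 0
   for all c in K, and Cramer's rule applied to the coefficients in c shows that a power of
   s t (t - s) acts as 0; then so does a power of t - s, because s divides p - a_0 t^n and
   t divides p - a_n s^n.
   (v) => (vi): let A be the algebra generated by the two projections x, y : R^2 -> R^1, and
   C its commutator ideal, generated by [x, y]. The Engel identity makes each C^k finitely
   generated as a left ideal modulo C^(k+1). Call a in A negligible if, for every finite set l,
   C is nilpotent modulo (l) as soon as it is so modulo (l, a), where everything is up to
   terms of C^m, m large. Finite generation implies that the negligible elements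
   form a semiprime ideal; and an algebra with the Engel identity is commutative modulo a
   semiprime ideal. So [x, y] is negligible, C^N lies in every C^k, and C^N = 0 because A is
   graded. Finally, with t the product of the two given elements, the difference of the two
   sides of the Morse identities satisfies d_(k+1) = [d_k, u_k], where u_k is t^(2^k) modulo C;
   since ad (t^m) factors through ad t, n steps lead from C^j to C^(j+1). *)

Require Import Defs.
From HB Require Import structures.
From mathcomp Require Import all_boot all_order all_algebra.
From mathcomp Require Import boolp functions ring zify.
Set Implicit Arguments. Unset Strict Implicit. Unset Printing Implicit Defensive.
Import Order.TTheory GRing.Theory Num.Theory.
Local Open Scope ring_scope.

(** * Vandermonde interpolation over an infinite domain *)

Section Interpolation.
Variables (K : idomainType) (M : lmodType K).
Hypothesis K_inf : infinite_type K.

Lemma infinite_uniq_seq m : exists s : seq K, uniq s /\ size s = m.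
Proof.
elim: m => [|m [s [us <-]]]; first by exists [::].
by have [a as'] := K_inf s; exists (a :: s); rewrite /= as'.
Qed.

(** The adjugate of the Vandermonde matrix at m distinct points expresses [\det A *: f i] through
    the evaluations. The determinant is nonzero, and saturation of P removes it, so no inverse in K
    enters. *)
Lemma coef_of_evaluations (P : M -> Prop) m (f : nat -> M) :
    P 0 -> (forall u v, P u -> P v -> P (u + v)) ->
    (forall (a : K) u, P u -> P (a *: u)) ->
    (forall (a : K) u, a != 0 -> P (a *: u) -> P u) ->
    (forall a : K, P (\sum_(i < m) a ^+ i *: f i)) ->
  forall i, (i < m)%N -> P (f i).
Proof.
move=> P0 PD PZ Psat Pf i im.
have [s [us szs]] := infinite_uniq_seq m.
pose r : 'rV[K]_m := \row_j s`_j.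
pose A : 'M[K]_m := (Vandermonde m r)^T.
have dA : \det A != 0.
  rewrite det_tr det_Vandermonde; apply/prodf_neq0 => j _; apply/prodf_neq0 => k jk.
  by rewrite !mxE subr_eq0 nth_uniq ?szs // neq_ltn jk orbT.
apply: (Psat _ _ dA).
have -> : \det A *: f i =
    \sum_(j < m) \adj A (Ordinal im) j *: \sum_(k < m) s`_j ^+ k *: f k.
  under eq_bigr do rewrite scaler_sumr.
  rewrite exchange_big /=.
  transitivity (\sum_(k < m) (\adj A *m A) (Ordinal im) k *: f k).
    rewrite mul_adj_mx (bigD1 (Ordinal im)) //= big1 ?addr0 => [|k nk].
      by rewrite mxE eqxx.
    by rewrite mxE eq_sym (negPf nk) scale0r.
  apply: eq_bigr => k _; rewrite mxE scaler_suml; apply: eq_bigr => j _.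
  by rewrite scalerA !mxE.
by elim/big_ind: _ => // j _; apply: PZ; exact: Pf.
Qed.

End Interpolation.

(** * Additive spans *)

Section Span.
Variable M : zmodType.
Implicit Types S T : M -> Prop.

(** Only sums are taken: the generating sets used below absorb scalars, so that these spans are
    submodules. *)
Inductive span S : M -> Prop :=
| span0 : span S 0
| spanD u v : span S u -> span S v -> span S (u + v)
| span_in u : S u -> span S u.

End Span.

Lemma span_map (M N : zmodType) (S : M -> Prop) (T : N -> Prop) (f : M -> N) u :
    f 0 = 0 -> {morph f : a b / a + b} ->
  (forall v, S v -> span T (f v)) -> span S u -> span T (f u).
Proof.
move=> f0 fD fS; elim=> [|a b _ Ha _ Hb|a /fS //]; first by rewrite f0; exact: span0.
by rewrite fD; exact: spanD.
Qed.

Lemma span_sub (M : zmodType) (S T : M -> Prop) u :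
  (forall v, S v -> span T v) -> span S u -> span T u.
Proof. exact: (@span_map M M S T id). Qed.

Lemma span_mul (A : pzRingType) (S T R : A -> Prop) u v :
    (forall u v, S u -> T v -> span R (u * v)) -> span S u -> span T v -> span R (u * v).
Proof.
move=> H Su Tv; apply: (@span_map A A S _ (fun u => u * v)) Su => [|a b|a Sa].
- by rewrite mul0r.
- by rewrite mulrDl.
apply: (@span_map A A T _ (fun v => a * v)) Tv => [|b c|b Tb]; last exact: H.
- by rewrite mulr0.
- by rewrite mulrDr.
Qed.

(** * Commutators and the operators [ad a] *)

Section Comm.
Variable A : pzRingType.
Implicit Types a b u v w : A.

Definition ad a u := u * a - a * u.

Lemma ad0 a : ad a 0 = 0. Proof. by rewrite /ad mul0r mulr0 subr0. Qed.
Lemma adD a : {morph ad a : u v / u + v}.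
Proof. by move=> u v; rewrite /ad mulrDl mulrDr opprD addrACA. Qed.
Lemma adN a : {morph ad a : u / - u}.
Proof. by move=> u; rewrite /ad mulNr mulrN opprB opprK addrC. Qed.
Lemma adM a u v : ad a (u * v) = ad a u * v + u * ad a v.
Proof. by rewrite /ad mulrBl mulrBr !mulrA [RHS]addrC subrKA. Qed.
Lemma ad_commMl a z u : z * a = a * z -> ad a (z * u) = z * ad a u.
Proof. by move=> za; rewrite adM {1}/ad za subrr mul0r add0r. Qed.
Lemma ad_comm a b u : a * b = b * a -> ad a (ad b u) = ad b (ad a u).
Proof.
move=> ab; have ab0 : ad a b = 0 by rewrite /ad ab subrr.
by rewrite {2}/ad adD adN !adM ab0 mulr0 addr0 mul0r add0r.
Qed.
Lemma ad_sum a I (r : seq I) (P : pred I) F :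
  ad a (\sum_(i <- r | P i) F i) = \sum_(i <- r | P i) ad a (F i).
Proof. by rewrite (big_morph (ad a) (adD a) (ad0 a)). Qed.
Lemma adMn a u n : ad a (u *+ n) = ad a u *+ n.
Proof. by rewrite /ad mulrnAl mulrnAr mulrnBl. Qed.
Lemma adn0 n a : iter n (ad a) 0 = 0.
Proof. by elim: n => //= n ->; rewrite ad0. Qed.
Lemma adnD n a u v : iter n (ad a) (u + v) = iter n (ad a) u + iter n (ad a) v.
Proof. by elim: n => //= n ->; rewrite adD. Qed.

(** Left and right multiplication by a commute, so this is the binomial formula for a power of their
    difference. *)
Lemma iter_ad a u n : iter n (ad a) u =
  \sum_(i < n.+1) (-1) ^+ i * (a ^+ i * u * a ^+ (n - i)) *+ 'C(n, i).
Proof.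
elim: n => [|n IHn]; first by rewrite big_ord_recl big_ord0 addr0 !expr0 mul1r mulr1 bin0 mulr1n mul1r.
rewrite iterS {}IHn {1}/ad mulr_suml mulr_sumr.
rewrite [RHS]big_ord_recl /= bin0 subn0 mulr1n.
rewrite [in RHS](eq_bigr (fun i : 'I_n.+1 =>
   (-1) ^+ i.+1 * (a ^+ i.+1 * u * a ^+ (n - i)) *+ 'C(n, i.+1) +
   (-1) ^+ i.+1 * (a ^+ i.+1 * u * a ^+ (n - i)) *+ 'C(n, i))); last first.
  by move=> i _; rewrite /bump /= add1n subSS binS mulrnDr.
rewrite big_split /= addrA; congr (_ + _).
  rewrite [in RHS]big_ord_recr /= bin_small // mulr0n addr0.
  rewrite big_ord_recl /= bin0 mulr1n subn0 !expr0 !mul1r -mulrA -exprSr; congr (_ + _).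
  apply: eq_bigr => i _; rewrite /bump /= add1n mulrnAl -!mulrA -exprSr.
  by rewrite subnSK.
rewrite -sumrN; apply: eq_bigr => i _.
by rewrite mulrnAr -mulNrn (mulrA a) (commr_sign a i) [in RHS]exprS mulN1r mulNr -!mulrA (mulrA a) -exprS.
Qed.

(** In characteristic p the inner binomial coefficients vanish, and only [u * a ^+ p] and
    [a ^+ p * u] remain. *)
Lemma ad_exp_prime a u p : prime p -> p%:R = 0 :> A -> iter p (ad a) u = ad (a ^+ p) u.
Proof.
move=> pp p0; rewrite iter_ad.
have p_gt0 := prime_gt0 pp.
rewrite big_ord_recl /= bin0 mulr1n !expr0 !mul1r subn0.
case: p p0 pp p_gt0 => // p p0 pp _.
rewrite big_ord_recr /= big1 ?add0r => [|i _].
  rewrite /bump /= add1n binn mulr1n subnn expr0 mulr1 /ad; congr (_ + _).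
  have [e|o] := boolP (odd p.+1); first by rewrite -signr_odd e expr1 mulN1r.
  (* An even exponent gives the last term the sign +1 instead of -1; the prime is then 2, and the
     two signs agree. *)
  have p2 : p.+1 = 2 by move: o; case/even_prime: pp => [//|->].
  rewrite -signr_odd (negPf o) expr0 mul1r.
  apply/eqP; rewrite -addr_eq0 -mulr2n -mulr_natl.
  have -> : (2%:R : A) = 0 by rewrite -p0 p2.
  by rewrite mul0r.
have /dvdnP[q ->] : (p.+1 %| 'C(p.+1, bump 0 i))%N.
  by apply: prime_dvd_bin => //; rewrite /bump /= add1n ltnS ltn_ord.
by rewrite mulrnA -mulr_natl p0 mul0r.
Qed.

Lemma ad_exp_prime_power a u p k :
  prime p -> p%:R = 0 :> A -> iter (p ^ k) (ad a) u = ad (a ^+ (p ^ k)) u.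
Proof.
move=> pp p0; elim: k u => [|k IHk] u; first by rewrite expn0 expr1.
rewrite expnSr exprM -ad_exp_prime // mulnC iterM; exact: eq_iter.
Qed.

(** A telescoping sum. It shows that ad (a^n) factors through ad a. *)
Lemma ad_pow a n u :
  ad (a ^+ n) u = ad a (\sum_(i < n) a ^+ i * u * a ^+ (n.-1 - i)).
Proof.
rewrite ad_sum; case: n => [|n]; first by rewrite big_ord0 /ad expr0 mulr1 mul1r subrr.
transitivity (\sum_(i < n.+1) (a ^+ i * u * a ^+ (n.+1 - i)
                - a ^+ i.+1 * u * a ^+ (n.+1 - i.+1))); last first.
  apply: eq_bigr => i _; rewrite /ad /= -!mulrA -exprSr !mulrA -exprS subSS subSn //.
  by rewrite -ltnS.
rewrite -(big_mkord xpredT (fun i => a ^+ i * u * a ^+ (n.+1 - i) - a ^+ i.+1 * u * a ^+ (n.+1 - i.+1))).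
rewrite (eq_bigr (fun i => - (a ^+ i.+1 * u * a ^+ (n.+1 - i.+1) - a ^+ i * u * a ^+ (n.+1 - i)))); last first.
  by move=> i _; rewrite opprB.
rewrite sumrN telescope_sumr // opprB.
by rewrite subn0 subnn expr0 mul1r mulr1.
Qed.

(** Values at a, b of the two sides of the Morse identity of index k + 1. *)
Fixpoint morse_pair a b k : A * A :=
  if k is j.+1 then let: (u, v) := morse_pair a b j in (u * v, v * u) else (a * b, b * a).

End Comm.

(** * Engel algebras are commutative modulo a saturated semiprime ideal *)

Section Semiprime.
Variables (K : idomainType) (A : algType K).
Hypothesis K_inf : infinite_type K.

(** [f i] collects the terms of degree i in b. In degree one every term but [a ^+ k * b] ends in a,
    and these are lumped together as [w * a]. *)
Lemma expansion_linear_coef (a b : A) k : exists (f : nat -> A) (w : A),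
  [/\ forall c : K, (a + c *: b) ^+ k.+1 = \sum_(i < k.+2) c ^+ i *: f i,
      f 0%N = a ^+ k.+1 & f 1%N = w * a + a ^+ k * b].
Proof.
elim: k => [|k [f [w [fE f0 f1]]]].
  exists (fun i => if i == 0%N then a else b), 0; split=> //= [c|].
    by rewrite !big_ord_recl big_ord0 /= addr0 !expr0 !expr1 scale1r.
  by rewrite mul0r add0r mul1r.
exists (fun i => (if (i <= k.+1)%N then f i * a else 0) + (if i is i'.+1 then f i' * b else 0)).
exists (f 1%N); split=> [c||]; last 2 first.
- by rewrite /= addr0 f0 -exprSr.
- by rewrite /= f0.
rewrite exprSr fE mulrDr; under [RHS]eq_bigr do rewrite scalerDr.
rewrite big_split /=; congr (_ + _).
  rewrite [RHS]big_ord_recr /= ltnn scaler0 addr0 mulr_suml; apply: eq_bigr => i _.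
  by rewrite -ltnS ltn_ord -scalerAl.
rewrite [RHS]big_ord_recl /= scaler0 add0r mulr_suml; apply: eq_bigr => i _.
by rewrite -scalerAl -scalerAr scalerA -exprSr.
Qed.

Variable Rad : A -> Prop.
Hypothesis Rad0 : Rad 0.
Hypothesis RadD : forall u v, Rad u -> Rad v -> Rad (u + v).
Hypothesis RadMl : forall u v, Rad v -> Rad (u * v).
Hypothesis RadMr : forall u v, Rad u -> Rad (u * v).
Hypothesis Rad_saturated : forall (c : K) u, c != 0 -> Rad (c *: u) -> Rad u.
Hypothesis Rad_semiprime : forall a, (forall r, Rad (a * r * a)) -> Rad a.

Lemma RadZ (c : K) u : Rad u -> Rad (c *: u).
Proof. by move=> Ru; rewrite -mulr_algl; apply: RadMl. Qed.

Lemma RadN u : Rad u -> Rad (- u).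
Proof. by move=> Ru; rewrite -mulN1r; apply: RadMl. Qed.

Lemma RadB u v : Rad u -> Rad v -> Rad (u - v).
Proof. by move=> Ru Rv; apply: RadD => //; apply: RadN. Qed.

Lemma Rad_ad a u : Rad u -> Rad (ad a u).
Proof. by move=> Ru; apply: RadB; [apply: RadMr | apply: RadMl]. Qed.

Local Notation "u ≡ v" := (Rad (u - v)) (at level 70).

Lemma congR u : u ≡ u. Proof. by rewrite subrr. Qed.
Lemma congT v u w : u ≡ v -> v ≡ w -> u ≡ w.
Proof. by move=> uv vw; rewrite -(subrKA v); apply: RadD. Qed.
Lemma congD u u' v v' : u ≡ u' -> v ≡ v' -> u + v ≡ u' + v'.
Proof. by move=> uu vv; rewrite opprD addrACA; apply: RadD. Qed.
Lemma congM u u' v v' : u ≡ u' -> v ≡ v' -> u * v ≡ u' * v'.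
Proof.
move=> uu vv; rewrite -(subrKA (u' * v)) -mulrBl -mulrBr.
by apply: RadD; [apply: RadMr | apply: RadMl].
Qed.
Lemma congMn u v k : u ≡ v -> u *+ k ≡ v *+ k.
Proof. by rewrite -mulrnBl -mulr_natl; exact: RadMl. Qed.
Lemma cong_ad a u v : u ≡ v -> ad a u ≡ ad a v.
Proof. by move=> uv; rewrite -adN -adD; apply: Rad_ad. Qed.
Lemma Rad_cong u v : u ≡ v -> Rad v -> Rad u.
Proof. by move=> uv Rv; rewrite -(subrK v u); apply: RadD. Qed.

Variable n : nat.
Hypothesis engelA : forall u v : A, iter n (ad v) u = 0.

(** With z = y r the product y z lies in Rad, so modulo Rad the operator ad z acts on z^i y as left
    multiplication by -z. After n steps the Engel identity applies. *)
Lemma Rad_square_zero_chain y r : Rad (y * y) -> Rad ((y * r) ^+ n * y).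
Proof.
move=> y2; set z := y * r.
have H i : iter i (ad z) y ≡ (-1) ^+ i * (z ^+ i * y).
  elim: i => [|i IHi]; first by rewrite !expr0 !mul1r; exact: congR.
  rewrite iterS; apply: congT (cong_ad z IHi) _.
  have -> : ad z ((-1) ^+ i * (z ^+ i * y)) - (-1) ^+ i.+1 * (z ^+ i.+1 * y) =
      (-1) ^+ i * z ^+ i * (y * y) * r.
    rewrite /ad (mulrA z) (commr_sign z i) [in X in _ - _ - X]exprS mulN1r mulNr opprK exprS -!mulrA subrK.
    by rewrite /z !mulrA.
  by apply: RadMr; apply: RadMl.
have := H n; rewrite engelA sub0r => /RadN; rewrite opprK => /(RadMl ((-1) ^+ n)).
by rewrite signrMK.
Qed.

(* Levitzki's argument: if (y r)^(m+1) y vanishes for all r, then the part that is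
   linear in s of (y (r + s))^(m+1) y, times r (y r)^(m-1) y, is (y r)^m y s (y r)^m y. *)
Lemma Rad_chain_down y m : (forall r, Rad ((y * r) ^+ m.+1 * y)) ->
  forall r, Rad ((y * r) ^+ m * y).
Proof.
case: m => [|m] H r.
  rewrite expr0 mul1r; apply: Rad_semiprime => s; by have := H s; rewrite expr1.
apply: Rad_semiprime => s.
have [f [w [fE _ f1]]] := expansion_linear_coef (y * r) (y * s) m.+1.
pose z := (y * r) ^+ m.+1 * y.
have : Rad (f 1%N * z).
  apply: (coef_of_evaluations K_inf (P := fun u => Rad (u * z)) (f := f) (m := m.+3)) => //.
  - by rewrite mul0r.
  - by move=> u v Ru Rv; rewrite mulrDl; apply: RadD.
  - by move=> a u Ru; rewrite -scalerAl; apply: RadZ.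
  - by move=> a u a0; rewrite -scalerAl => /(Rad_saturated a0).
  (* As z begins with y, each evaluation is a right multiple of [(y * (r + a *: s)) ^+ m.+2 * y], to
     which H applies. *)
  have zE : z = y * (r * ((y * r) ^+ m * y)) by rewrite /z exprS -!mulrA.
  by move=> a; rewrite -fE zE scalerAr -mulrDr [X in Rad X]mulrA; apply: RadMr; exact: H.
rewrite f1 mulrDl => /RadB /(_ (RadMl w (H r))).
have -> : w * (y * r) * z = w * ((y * r) ^+ m.+2 * y).
  by rewrite /z -(mulrA w) [in RHS]exprS !mulrA.
by rewrite addrAC subrr add0r /z !mulrA.
Qed.

Lemma Rad_sqr y : Rad (y * y) -> Rad y.
Proof.
move=> y2; have : forall r, Rad ((y * r) ^+ n * y) by move=> r; apply: Rad_square_zero_chain.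
elim: n => [|m IHm] H; last by apply: IHm; apply: Rad_chain_down.
by have := H 0; rewrite expr0 mul1r.
Qed.

(** The exponent is raised to 2^k, and then k square roots are taken. *)
Lemma Rad_exp y k : Rad (y ^+ k) -> Rad y.
Proof.
move=> yk; have : Rad (y ^+ (2 ^ k)).
  rewrite -(subnK (ltnW (ltn_expl k (ltnSn 1)))) exprD; exact: RadMl.
elim: k {yk} => [|k IHk]; first by rewrite expr1.
by rewrite expnSr exprM expr2 => /Rad_sqr.
Qed.

(** * The Kleinecke-Shirokov argument for inner derivations *)

Section Kleinecke.
Variables a w : A.
Let e := ad a w.
Hypothesis ade : Rad (ad a e).

(** Leibniz's rule: [ad a] sends w to e and e into Rad, so w can be differentiated at most once. *)
Lemma iter_ad_mulr m u :
  iter m.+1 (ad a) (u * w) ≡ iter m.+1 (ad a) u * w + iter m (ad a) u * e *+ m.+1.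
Proof.
elim: m u => [|m IHm] u; first by rewrite /= mulr1n adM; exact: congR.
rewrite iterSr adM adnD; apply: congT (congD (IHm _) _) _.
  have H : forall k v, iter k (ad a) (v * e) ≡ iter k (ad a) v * e.
    elim=> [|k IHk] v; first exact: congR.
    rewrite !iterS; apply: congT (cong_ad a (IHk v)) _.
    by rewrite adM addrAC subrr add0r; apply: RadMl.
  exact: H.
rewrite -!iterSr [_ *+ m.+2]mulrSr addrA; exact: congR.
Qed.

Lemma ad_exp_Rad k : Rad (ad a (e ^+ k)).
Proof.
elim: k => [|k IHk]; first by rewrite expr0 /ad mul1r mulr1 subrr.
by rewrite exprS adM; apply: RadD; [apply: RadMr | apply: RadMl].
Qed.

(** Write D for [ad a]. By Leibniz's rule, k + 1 derivatives of w^(k+1) put one on the last w and k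
    on w^k, in k + 1 ways; putting all of them on w^k gives 0 modulo Rad, since D already kills
    D^k(w^k). *)
Lemma iter_ad_exp k : iter k (ad a) (w ^+ k) ≡ e ^+ k *+ k`!.
Proof.
elim: k => [|k IHk]; first by rewrite !expr0 fact0 mulr1n; exact: congR.
rewrite exprSr; apply: congT (iter_ad_mulr k _) _.
rewrite exprSr factS mulnC mulrnA -(mulrnAl _ _ k`!) -[X in _ - X]add0r.
apply: congD; last by apply: congMn; apply: congM => //; exact: congR.
rewrite subr0; apply: RadMr; rewrite iterS; apply: Rad_cong (cong_ad a IHk) _.
by rewrite adMn -mulr_natl; apply: RadMl; exact: ad_exp_Rad.
Qed.

(* In characteristic p, E = e^(p^n) is central, and g = w e^(p^n - 1) a satisfies
   [a, g] = - E a, so that the Engel identity for (a, g) gives E^n a = 0. *)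
Lemma Rad_ad_prime_char p : prime p -> p%:R = 0 :> K -> Rad e.
Proof.
move=> pp p0.
have p0A : p%:R = 0 :> A by rewrite -scaler_nat p0 scale0r.
pose q := (p ^ n)%N; have q_gt0 : (0 < q)%N by rewrite expn_gt0 prime_gt0.
pose E := e ^+ q.
(* [ad E] is the q-th iterate of [ad e], and q = p^n is at least n, so the Engel identity makes E
   central. *)
have Ec u : E * u = u * E.
  apply/esym/subr0_eq; rewrite -/(ad E u) /E -ad_exp_prime_power // -/q.
  have nq : (n <= q)%N := ltnW (ltn_expl n (prime_gt1 pp)).
  by rewrite -(subnK nq) iterD engelA adn0.
pose g := w * e ^+ q.-1 * a.
have ag : ad g a ≡ - (E * a).
  have -> : ad g a - - (E * a) = - (w * ad a (e ^+ q.-1) * a).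
    rewrite opprK /E -(prednK q_gt0) exprS {1}/e /ad /g.
    rewrite !(mulrBl, mulrBr) !mulrA.
    by rewrite addrC subrKA opprB.
  by apply: RadN; apply: RadMr; apply: RadMl; exact: ad_exp_Rad.
have H i : iter i (ad g) a ≡ (- E) ^+ i * a.
  elim: i => [|i IHi]; first by rewrite expr0 mul1r; exact: congR.
  rewrite iterS; apply: congT (cong_ad g IHi) _.
  have -> : ad g ((- E) ^+ i * a) = (- E) ^+ i * ad g a.
    by apply: ad_commMl; apply/esym/commrX; rewrite /GRing.comm mulrN mulNr Ec.
  by rewrite exprSr -mulrA mulNr; apply: congM => //; exact: congR.
have {H} ENa : Rad ((- E) ^+ n * a).
  by have := H n; rewrite engelA sub0r => /RadN; rewrite opprK.
have ENc u : (- E) ^+ n * u = u * (- E) ^+ n.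
  by apply/esym/commrX; rewrite /GRing.comm mulrN mulNr Ec.
(* As e = w a - a w and E is central, E^n e lies in Rad together with E^n a; up to sign this is a
   power of e. *)
have : Rad ((- E) ^+ n * e).
  rewrite /e /ad mulrBr (mulrA _ w) ENc -mulrA (mulrA _ a).
  by apply: RadB; [apply: RadMl | apply: RadMr].
rewrite exprNn -mulrA => /(RadMl ((-1) ^+ n)).
rewrite signrMK.
by rewrite /E -exprM -exprSr => /Rad_exp.
Qed.

(** If n! vanishes in K, the characteristic is a prime. Otherwise n! e^n lies in Rad by the Engel
    identity for w^n, and saturation removes n!. *)
Lemma Rad_ad_of_Rad_ad2 : Rad e.
Proof.
case: (eqVneq (n`!%:R : K) 0) => [n0|n0].
  have [p /andP[pp /eqP p0]] := natf0_pchar (fact_gt0 n) (introT eqP n0).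
  exact: Rad_ad_prime_char pp p0.
have := iter_ad_exp n; rewrite engelA sub0r => /RadN; rewrite opprK.
by rewrite -scaler_nat => /(Rad_saturated n0) /Rad_exp.
Qed.

End Kleinecke.

(** The exponent of the Engel identity modulo Rad is lowered one by one, by applying
    [Rad_ad_of_Rad_ad2] to iterated commutators. *)
Theorem Rad_commutator a u : Rad (ad a u).
Proof.
have H m : (forall v, Rad (iter m.+1 (ad a) v)) -> forall v, Rad (ad a v).
  elim: m => // m IHm H; apply: IHm => v.
  by apply: Rad_ad_of_Rad_ad2; exact: H.
by apply: (H n) => v; rewrite iterS engelA ad0.
Qed.

End Semiprime.

(** * Powers of the commutator ideal C of a two-generated algebra *)

Section CommutatorIdeal.
Variables (K : idomainType) (A : algType K) (x y : A).
Implicit Types (u v w r s t a : A) (l L : seq A).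

Hypothesis generated : forall S : A -> Prop,
  S 1 -> S x -> S y -> (forall u v, S u -> S v -> S (u + v)) ->
  (forall (c : K) u, S u -> S (c *: u)) ->
  (forall u v, S u -> S v -> S (u * v)) -> forall u, S u.

Let com := x * y - y * x.

(** This is C^k. The factor p already ranges over the two-sided ideal C^j, so only a right cofactor
    is added at each stage. *)
Fixpoint cpow k : A -> Prop :=
  if k is j.+1 then span (fun u => exists p t, cpow j p /\ u = p * com * t)
  else fun=> True.

Arguments cpow : simpl never.

Lemma cpow_0 k : cpow k 0.
Proof. by case: k => [|k] //; exact: span0. Qed.

Lemma cpowD k u v : cpow k u -> cpow k v -> cpow k (u + v).
Proof. by case: k => [|k] //; exact: spanD. Qed.

Lemma cpowMl k r u : cpow k u -> cpow k (r * u).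
Proof.
elim: k r u => [|k IHk] r u //.
apply: (@span_map _ _ _ _ (fun u => r * u)) => [|a b|v [p [t [kp ->]]]].
- by rewrite mulr0.
- by rewrite mulrDr.
by apply: span_in; exists (r * p), t; split; [exact: IHk | rewrite !mulrA].
Qed.

Lemma cpowMr k r u : cpow k u -> cpow k (u * r).
Proof.
case: k => [|k] //.
apply: (@span_map _ _ _ _ (fun u => u * r)) => [|a b|v [p [t [kp ->]]]].
- by rewrite mul0r.
- by rewrite mulrDl.
by apply: span_in; exists p, (t * r); split => //; rewrite !mulrA.
Qed.

Lemma cpowZ k (c : K) u : cpow k u -> cpow k (c *: u).
Proof. by rewrite -mulr_algl; exact: cpowMl. Qed.

Lemma cpowN k u : cpow k u -> cpow k (- u).
Proof. by rewrite -mulN1r; exact: cpowMl. Qed.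

Lemma cpowB k u v : cpow k u -> cpow k v -> cpow k (u - v).
Proof. by move=> ku kv; apply: cpowD => //; exact: cpowN. Qed.

Lemma cpow_sum k I (r : seq I) (P : pred I) F :
  (forall i, P i -> cpow k (F i)) -> cpow k (\sum_(i <- r | P i) F i).
Proof.
by move=> H; elim/big_ind: _ => //; [exact: cpow_0 | move=> *; exact: cpowD].
Qed.

Lemma cpowS k u : cpow k.+1 u -> cpow k u.
Proof.
elim=> [|v w _ Hv _ Hw|v [p [t [kp ->]]]]; [exact: cpow_0 | exact: cpowD|].
by rewrite -mulrA; exact: cpowMr.
Qed.

Lemma cpow_le j k u : (j <= k)%N -> cpow k u -> cpow j u.
Proof.
move=> /subnK <-; elim: (k - j)%N => [|m IHm] //.
by rewrite addSn => /cpowS; exact: IHm.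
Qed.

Lemma cpowM i j u v : cpow i u -> cpow j v -> cpow (i + j) (u * v).
Proof.
elim: j v => [|j IHj] v iu; first by rewrite addn0 => _; exact: cpowMr.
rewrite addnS; apply: (@span_map _ _ _ _ (fun v => u * v)) => [|a b|w [p [t [jp ->]]]].
- by rewrite mulr0.
- by rewrite mulrDr.
by apply: span_in; exists (u * p), t; split; [exact: IHj | rewrite !mulrA].
Qed.

Lemma cpow_split i j u : cpow (i + j) u ->
  span (fun w => exists p q, [/\ cpow i p, cpow j q & w = p * q]) u.
Proof.
elim: j u => [|j IHj] u.
  by rewrite addn0 => iu; apply: span_in; exists u, 1; rewrite mulr1.
rewrite addnS; apply: span_sub => v [p [t [/IHj ijp ->]]].
rewrite -mulrA; move: ijp; apply: (@span_map _ _ _ _ (fun p => p * (com * t))).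
- by rewrite mul0r.
- by move=> a b; rewrite mulrDl.
move=> w [a [b [ia jb ->]]]; apply: span_in; exists a, (b * com * t); split=> //.
  by apply: span_in; exists b, t.
by rewrite !mulrA.
Qed.

Lemma cpow_com : cpow 1 com.
Proof. by apply: span_in; exists 1, 1; rewrite mulr1 mul1r. Qed.

(** [ad w] is a derivation, so it suffices to check the generators; antisymmetry then reduces the
    other argument to generators as well. *)
Lemma cpow_ad u v : cpow 1 (ad v u).
Proof.
have H w : cpow 1 (ad w x) -> cpow 1 (ad w y) -> forall u, cpow 1 (ad w u).
  move=> wx wy; apply: generated => // [|a b|c a|a b].
  - by rewrite /ad mul1r mulr1 subrr; exact: span0.
  - by rewrite adD; exact: cpowD.
  - by rewrite /ad -scalerAl -scalerAr -scalerBr; exact: cpowZ.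
  - by rewrite adM => wa wb; apply: cpowD; [exact: cpowMr | exact: cpowMl].
have ad_sym a b : ad a b = - ad b a by rewrite /ad opprB.
have xx a : ad a a = 0 by rewrite /ad subrr.
apply: (H); rewrite ad_sym; apply: cpowN; apply: (H); rewrite ?xx; try exact: cpow_0.
- by rewrite ad_sym; apply: cpowN; exact: cpow_com.
- exact: cpow_com.
Qed.

(** * Finite generation of C^k modulo C^(k+1) *)

Definition fin_gen k L := (forall h, h \in L -> cpow k h) /\
  forall u, cpow k u ->
    span (fun w => (exists a h, h \in L /\ w = a * h) \/ cpow k.+1 w) u.

Lemma fin_gen0 : fin_gen 0 [:: 1].
Proof.
split=> // u _; apply: span_in; left; exists u, 1.
by rewrite inE mulr1.
Qed.

(** In p q the factor q is first written through L2. Its coefficients are absorbed by p, which stays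
    in C^i and is then written through L1. Both remainders gain one power of C. *)
Lemma fin_genM i j L1 L2 : fin_gen i L1 -> fin_gen j L2 ->
  fin_gen (i + j) [seq h1 * h2 | h1 <- L1, h2 <- L2].
Proof.
move=> [L1i g1] [L2j g2]; split.
  by move=> _ /allpairsP[[h1 h2] /= [/L1i ? /L2j ? ->]]; exact: cpowM.
move=> u /cpow_split; apply: span_sub => z' [p [q [ip jq ->]]]; move: (g2 _ jq).
apply: (@span_map _ _ _ _ (fun q => p * q)) => [|a b|w1 [[a [h [hL ->]]]|jw]].
- by rewrite mulr0.
- by rewrite mulrDr.
- rewrite mulrA; have /g1 := cpowMr a ip.
  apply: (@span_map _ _ _ _ (fun q => q * h)) => [|b b'|w2 [[b [h1 [hL1 ->]]]|iw]].
  + by rewrite mul0r.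
  + by rewrite mulrDl.
  + apply: span_in; left; exists b, (h1 * h); rewrite mulrA; split=> //.
    by apply/allpairsP; exists (h1, h).
  + by apply: span_in; right; rewrite -addSn; apply: cpowM => //; exact: L2j.
- by apply: span_in; right; rewrite -addnS; apply: cpowM.
Qed.

Variable n : nat.
Hypothesis engelA : forall u v : A, iter n (ad v) u = 0.

(** The expanded Engel identity, solved for its term without left factor: a right factor v^n is
    traded for lower powers of v, at the cost of left factors. *)
Lemma engel_leading u v : u * v ^+ n =
  \sum_(i < n) - ((-1) ^+ i.+1 * v ^+ i.+1 * (u * v ^+ (n - i.+1)) *+ 'C(n, i.+1)).
Proof.
rewrite sumrN; apply/eqP; rewrite -addr_eq0 -{1}[u * _]mulr1n -(bin0 n); apply/eqP.
rewrite -[RHS](engelA u v) iter_ad big_ord_recl /= expr0 !mul1r subn0; congr (_ + _).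
by apply: eq_bigr => i _; rewrite /bump /= add1n !mulrA.
Qed.

(** The generators are com x^i y^j with i, j < n. The left ideal that they span modulo C^2 is stable
    under right multiplication by x and y: [engel_leading] bounds the exponents, and x and y commute
    behind com modulo C^2. *)
Lemma fin_gen1 : exists L, fin_gen 1 L.
Proof.
pose L := [seq com * x ^+ i * y ^+ j | i <- iota 0 n, j <- iota 0 n].
exists L; split.
  by move=> _ /allpairsP[[i j] /= [_ _ ->]]; do 2!apply: cpowMr; exact: cpow_com.
pose S := span (fun w => (exists a h, h \in L /\ w = a * h) \/ cpow 2 w).
have SMl a u : S u -> S (a * u).
  apply: (@span_map _ _ _ _ (fun u => a * u)) => [|b c|w3 [[b [h [hL ->]]]|iw]].
  - by rewrite mulr0.
  - by rewrite mulrDr.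
  - by apply: span_in; left; exists (a * b), h; rewrite mulrA.
  - by apply: span_in; right; exact: cpowMl.
have S2 u : cpow 2 u -> S u by move=> u2; apply: span_in; right.
have Ssum m F : (forall i : 'I_m, S (F i)) -> S (\sum_i F i).
  by move=> H; elim/big_ind: _ => //; [exact: span0 | move=> *; exact: spanD].
have SMn u k : S u -> S (- (u *+ k)).
  by move=> Su; rewrite -mulr_natl -mulNr; exact: SMl.
have Sgen i j : (i < n)%N -> (j < n)%N -> S (com * x ^+ i * y ^+ j).
  move=> lin ljn; apply: span_in; left; exists 1, (com * x ^+ i * y ^+ j).
  by rewrite mul1r; split=> //; apply: allpairs_f; rewrite mem_iota.
have Sgen_y i j : (i < n)%N -> (j <= n)%N -> S (com * x ^+ i * y ^+ j).
  move=> lin; rewrite leq_eqVlt => /orP[/eqP ->|]; last exact: Sgen.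
  rewrite engel_leading; apply: Ssum => k; apply: SMn; apply: SMl; apply: Sgen => //.
  by have := ltn_ord k; lia.
have Sgen_x i j : (i <= n)%N -> (j < n)%N -> S (com * x ^+ i * y ^+ j).
  rewrite leq_eqVlt => /orP[/eqP ->|]; last exact: Sgen.
  move=> ljn; rewrite engel_leading mulr_suml; apply: Ssum => k.
  rewrite mulNr mulrnAl -[_ * y ^+ j]mulrA; apply: SMn; apply: SMl; apply: Sgen => //.
  by have := ltn_ord k; lia.
have SMr z : (forall i j, (i < n)%N -> (j < n)%N -> S (com * x ^+ i * y ^+ j * z)) ->
    forall u, S u -> S (u * z).
  move=> Hz u; apply: (@span_map _ _ _ _ (fun u => u * z)) => [|b c|w4 [[b [_ [/allpairsP[[i j] /= [+ + ->]] ->]]]|iw]].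
  - by rewrite mul0r.
  - by rewrite mulrDl.
  - by rewrite !mem_iota /= !add0n => lin ljn; rewrite -mulrA; apply: SMl; exact: Hz.
  - by apply: S2; exact: cpowMr.
have SMy u : S u -> S (u * y).
  by apply: SMr => i j lin ljn; rewrite -mulrA -exprSr; exact: Sgen_y.
have SMx u : S u -> S (u * x).
  apply: SMr => i j lin ljn.
  (* Moving x to the left across y^j leaves a commutator behind com, hence an element of C^2. *)
  have -> : com * x ^+ i * y ^+ j * x = com * x ^+ i.+1 * y ^+ j + com * x ^+ i * ad x (y ^+ j).
    by rewrite /ad exprSr mulrBr !mulrA addrC subrK.
  apply: spanD; first exact: Sgen_x.
  by apply: S2; apply: (@cpowM 1 1); [apply: cpowMr; exact: cpow_com | exact: cpow_ad].
have SMz z : forall u, S u -> S (u * z).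
  elim/generated: z => // [u|a b Ha Hb u Su|c a Ha u Su|a b Ha Hb u Su].
  - by rewrite mulr1.
  - by rewrite mulrDr; apply: spanD; [exact: Ha | exact: Hb].
  - by rewrite -scalerAr -mulr_algl; apply: SMl; exact: Ha.
  - by rewrite mulrA; apply: Hb; exact: Ha.
have Scom : S com.
  (* For n = 0 the list of generators is empty, but the Engel identity then says that every element
     is 0. *)
  case: (posnP n) => [n0|n_gt0]; last by have := Sgen 0 0 n_gt0 n_gt0; rewrite !expr0 !mulr1.
  have -> : com = 0 by rewrite -(engelA com com) n0.
  exact: span0.
move=> u; apply: span_sub => _ [p [t [_ ->]]].
by apply: SMz; exact: SMl.
Qed.

Lemma fin_gen_exists k : exists L, fin_gen k L.
Proof.
elim: k => [|k [L HL]]; first by exists [:: 1]; exact: fin_gen0.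
by have [G HG] := fin_gen1; have := fin_genM HL HG; rewrite addn1; exists [seq h1 * h2 | h1 <- L, h2 <- G].
Qed.

(** * Nilpotency of C modulo finitely generated ideals *)

Definition ideal l := span (fun w => exists s a t, a \in l /\ w = s * a * t).

Definition ideal_cpow l m := span (fun w => (exists s a t, a \in l /\ w = s * a * t) \/ cpow m w).

(** Nilpotency is asked only up to a nonzero scalar, as K need not be a field, and only for one step
    from C^N to C^(N+1); [cpow_collapse] iterates that step. *)
Definition nil_mod l := exists N (c : K), c != 0 /\
  forall u, cpow N u -> ideal_cpow l N.+1 (c *: u).

Lemma ideal_cpowMl l m r u : ideal_cpow l m u -> ideal_cpow l m (r * u).
Proof.
apply: (@span_map _ _ _ _ (fun u => r * u)) => [|a b|w5 [[s [a [t [al ->]]]]|mw]].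
- by rewrite mulr0.
- by rewrite mulrDr.
- by apply: span_in; left; exists (r * s), a, t; rewrite !mulrA.
- by apply: span_in; right; exact: cpowMl.
Qed.

Lemma ideal_cpowMr l m r u : ideal_cpow l m u -> ideal_cpow l m (u * r).
Proof.
apply: (@span_map _ _ _ _ (fun u => u * r)) => [|a b|w6 [[s [a [t [al ->]]]]|mw]].
- by rewrite mul0r.
- by rewrite mulrDl.
- by apply: span_in; left; exists s, a, (t * r); rewrite !mulrA.
- by apply: span_in; right; exact: cpowMr.
Qed.

Lemma ideal_cpowZ l m (c : K) u : ideal_cpow l m u -> ideal_cpow l m (c *: u).
Proof. by rewrite -mulr_algl; exact: ideal_cpowMl. Qed.

Lemma ideal_cpowB l m u v : ideal_cpow l m u -> ideal_cpow l m v -> ideal_cpow l m (u - v).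
Proof. by move=> ku kv; apply: spanD => //; rewrite -mulN1r; exact: ideal_cpowMl. Qed.

Lemma ideal_cpow_sub l l' m u : (forall a, a \in l -> ideal_cpow l' m a) ->
  ideal_cpow l m u -> ideal_cpow l' m u.
Proof.
move=> ll'; apply: span_sub => w7 [[s [a [t [/ll' al ->]]]]|mw].
  by apply: ideal_cpowMr; exact: ideal_cpowMl.
by apply: span_in; right.
Qed.

Lemma ideal_cpow_in l m a : a \in l -> ideal_cpow l m a.
Proof. by move=> al; apply: span_in; left; exists 1, a, 1; rewrite mul1r mulr1. Qed.

Lemma ideal_cpowM l i j u v :
  ideal_cpow l i u -> ideal_cpow l j v -> ideal_cpow l (i + j) (u * v).
Proof.
move=> + jv; apply: (@span_map _ _ _ _ (fun u => u * v)) => [|a b|w8 [[s [a [t [al ->]]]]|iw]].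
- by rewrite mul0r.
- by rewrite mulrDl.
- by do 2!apply: ideal_cpowMr; apply: ideal_cpowMl; exact: ideal_cpow_in.
move: jv; apply: (@span_map _ _ _ _ (fun v => _ * v)) => [|a b|w9 [[s [a [t [al ->]]]]|jw]].
- by rewrite mulr0.
- by rewrite mulrDr.
- by apply: ideal_cpowMl; apply: ideal_cpowMr; apply: ideal_cpowMl; exact: ideal_cpow_in.
- by apply: span_in; right; exact: cpowM.
Qed.

Lemma ideal_cpow_cat l l' m u : ideal_cpow (l ++ l') m u ->
  exists v, ideal l v /\ ideal_cpow l' m (u - v).
Proof.
elim=> [|a b _ [v [lv av]] _ [w [lw bw]]|w [[s [a [t [al ->]]]]|mw]].
- by exists 0; rewrite subrr; split; exact: span0.
- exists (v + w); split; first exact: spanD.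
  by rewrite opprD addrACA; exact: spanD.
- move: al; rewrite mem_cat => /orP[] al.
    exists (s * a * t); rewrite subrr; split; last exact: span0.
    by apply: span_in; exists s, a, t.
  exists 0; rewrite subr0; split; first exact: span0.
  by apply: span_in; left; exists s, a, t.
- by exists 0; rewrite subr0; split; [exact: span0 | apply: span_in; right].
Qed.

Lemma nil_mod_sub l l' : (forall a m, a \in l -> ideal_cpow l' m a) ->
  nil_mod l -> nil_mod l'.
Proof.
move=> ll' [N [c [c0 H]]]; exists N, c; split=> // u /H.
by apply: ideal_cpow_sub => a; exact: ll'.
Qed.

(** (s a t)(s' a t') = s (a r a) t' with r = t s', and u v is a finite sum of such products. *)
Lemma ideal_mul_sandwich a u v : ideal [:: a] u -> ideal [:: a] v ->
  exists rs, ideal [seq a * r * a | r <- rs] (u * v).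
Proof.
have sub rs rs' w : {subset rs <= rs'} -> ideal [seq a * r * a | r <- rs] w -> ideal [seq a * r * a | r <- rs'] w.
  move=> ss; apply: span_sub => _ [s [b [t [/mapP[r rrs ->] ->]]]].
  by apply: span_in; exists s, (a * r * a), t; split=> //; apply: map_f; exact: ss.
have cat_l rs rs' w : ideal [seq a * r * a | r <- rs] w -> ideal [seq a * r * a | r <- rs ++ rs'] w.
  by apply: sub => r; rewrite mem_cat => ->.
have cat_r rs rs' w : ideal [seq a * r * a | r <- rs'] w -> ideal [seq a * r * a | r <- rs ++ rs'] w.
  by apply: sub => r; rewrite mem_cat orbC => ->.
move=> + av; elim=> [|u1 u2 _ [rs1 H1] _ [rs2 H2]|w10 [s [b [t [+ ->]]]]].
- by exists [::]; rewrite mul0r; exact: span0.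
- by exists (rs1 ++ rs2); rewrite mulrDl; apply: spanD; [exact: cat_l | exact: cat_r].
rewrite inE => /eqP ->; elim: av => [|u1 u2 _ [rs1 H1] _ [rs2 H2]|w11 [s' [b' [t' [+ ->]]]]].
- by exists [::]; rewrite mulr0; exact: span0.
- by exists (rs1 ++ rs2); rewrite mulrDr; apply: spanD; [exact: cat_l | exact: cat_r].
rewrite inE => /eqP ->; exists [:: t * s'].
by apply: span_in; exists s, (a * (t * s') * a), t'; rewrite inE eqxx !mulrA.
Qed.

(** The exponent N and the scalar c become 2N and c^2. Products of pairs from a finite list
    generating C^N generate C^(2N) modulo the next power, so finitely many r suffice. *)
Lemma nil_mod_sandwich a l : nil_mod (a :: l) ->
  exists rs, nil_mod ([seq a * r * a | r <- rs] ++ l).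
Proof.
move=> [N [c [c0 H]]]; have [L HL] := fin_gen_exists N.
pose good rs w := ideal_cpow ([seq a * r * a | r <- rs] ++ l) (N + N).+1 (c ^+ 2 *: w).
have good_sub rs rs' w : {subset rs <= rs'} -> good rs w -> good rs' w.
  move=> ss; apply: ideal_cpow_sub => b; rewrite mem_cat => /orP[/mapP[r rrs ->]|bl].
    by apply: ideal_cpow_in; rewrite mem_cat (map_f (fun r => a * r * a)) ?ss.
  by apply: ideal_cpow_in; rewrite mem_cat bl orbT.
have pair h1 h2 : h1 \in L -> h2 \in L -> exists rs, good rs (h1 * h2).
  move=> /(proj1 HL) N1 /(proj1 HL) N2.
  have /(@ideal_cpow_cat [:: a]) [v1 [av1 E1]] := H _ N1.
  have /(@ideal_cpow_cat [:: a]) [v2 [av2 E2]] := H _ N2.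
  have [rs Hrs] := ideal_mul_sandwich av1 av2; exists rs.
  pose l' := [seq a * r * a | r <- rs] ++ l.
  have up m w : ideal_cpow l m w -> ideal_cpow l' m w.
    by apply: ideal_cpow_sub => b bl; apply: ideal_cpow_in; rewrite mem_cat bl orbT.
  have cN w : cpow N w -> ideal_cpow l' N (c *: w).
    by move=> Nw; apply: span_in; right; exact: cpowZ.
  (* v1 and v2 are the components in (a). Each of the other three products has one factor in (l) +
     C^(N+1) and the other at least in (l) + C^N, so it lies in (l) + C^(2N+1). *)
  rewrite /good; have -> : c ^+ 2 *: (h1 * h2) = v1 * v2 + ((c *: h1) * (c *: h2 - v2)
      + (c *: h1 - v1) * (c *: h2) - (c *: h1 - v1) * (c *: h2 - v2)).
    rewrite -[X in _ = _ + X]addrA -mulrBr opprB subrKC.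
    rewrite mulrBr mulrBl subrKA [RHS]addrC subrK.
    by rewrite -scalerAl -scalerAr scalerA.
  apply: spanD.
    move: Hrs; apply: span_sub => _ [s [b [t [bl ->]]]]; apply: span_in; left.
    by exists s, b, t; rewrite mem_cat bl.
  apply: ideal_cpowB; first apply: spanD.
  - by rewrite -addnS; apply: ideal_cpowM; [exact: cN | exact: up].
  - by rewrite -addSn; apply: ideal_cpowM; [exact: up | exact: cN].
  have := ideal_cpowM (up _ _ E1) (up _ _ E2).
  apply: span_sub => w [Hw|Hw]; apply: span_in; [by left|right].
  by move: Hw; apply: cpow_le; rewrite addSn addnS.
have all_pairs (P : seq A) : {subset P <= [seq h1 * h2 | h1 <- L, h2 <- L]} ->
    exists rs, forall w, w \in P -> good rs w.
  elim: P => [|w P IHP] PL; first by exists [::].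
  have [|rs1 H1] := IHP; first by move=> z zP; apply: PL; rewrite inE zP orbT.
  have /allpairsP[[h1 h2] /= [h1L h2L wE]] := PL w (mem_head _ _).
  have [rs2 H2] := pair _ _ h1L h2L; exists (rs1 ++ rs2) => z; rewrite inE => /orP[/eqP ->|/H1].
    by rewrite wE; apply: good_sub H2 => r; rewrite mem_cat orbC => ->.
  by apply: good_sub => r; rewrite mem_cat => ->.
have [rs Hrs] := all_pairs _ (fun _ => id); exists rs, (N + N)%N, (c ^+ 2).
rewrite expf_neq0 //; split=> // u /(proj2 (fin_genM HL HL)).
apply: (@span_map _ _ _ _ (fun w => c ^+ 2 *: w)) => [|v w|w12 [[s [h [/Hrs hL ->]]]|Nw]].
- by rewrite scaler0.
- by rewrite scalerDr.
- by rewrite scalerAr; exact: ideal_cpowMl.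
- by apply: span_in; right; exact: cpowZ.
Qed.

(** * The ideal of negligible elements *)

Definition negligible a := forall l, nil_mod (a :: l) -> nil_mod l.

Lemma negligible0 : negligible 0.
Proof.
move=> l; apply: nil_mod_sub => a m; rewrite inE => /orP[/eqP ->|]; first exact: span0.
exact: ideal_cpow_in.
Qed.

Lemma negligibleD a b : negligible a -> negligible b -> negligible (a + b).
Proof.
move=> Qa Qb l H; apply: Qa; apply: Qb; move: H; apply: nil_mod_sub => z m.
rewrite inE => /orP[/eqP ->|zl]; last by apply: ideal_cpow_in; rewrite !inE zl !orbT.
by apply: spanD; apply: ideal_cpow_in; rewrite !inE eqxx ?orbT.
Qed.

Lemma negligibleM s a t : negligible a -> negligible (s * a * t).
Proof.
move=> Qa l H; apply: Qa; move: H; apply: nil_mod_sub => z m.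
rewrite inE => /orP[/eqP ->|zl]; last by apply: ideal_cpow_in; rewrite !inE zl !orbT.
by apply: ideal_cpowMr; apply: ideal_cpowMl; apply: ideal_cpow_in; rewrite inE eqxx.
Qed.

(** The factor c is absorbed into the scalar that [nil_mod] allows. *)
Lemma negligible_saturated (c : K) a : c != 0 -> negligible (c *: a) -> negligible a.
Proof.
move=> c0 Qa l [N [d [d0 H]]]; apply: Qa; exists N, (c * d).
rewrite mulf_neq0 //; split=> // u /H; rewrite -scalerA.
apply: (@span_map _ _ _ _ (fun w => c *: w)) => [|v w|w13 [[s [h [t [+ ->]]]]|Nw]].
- by rewrite scaler0.
- by rewrite scalerDr.
- rewrite inE => /orP[/eqP ->|hl].
    by rewrite scalerAl scalerAr; apply: ideal_cpowMr; apply: ideal_cpowMl; apply: ideal_cpow_in; rewrite inE eqxx.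
  apply: ideal_cpowZ; apply: ideal_cpowMr; apply: ideal_cpowMl; apply: ideal_cpow_in.
  by rewrite inE hl orbT.
- by apply: span_in; right; exact: cpowZ.
Qed.

(** [nil_mod_sandwich] replaces a by finitely many elements a r a, which are then discarded one at a
    time. *)
Lemma negligible_semiprime a : (forall r, negligible (a * r * a)) -> negligible a.
Proof.
move=> H l /nil_mod_sandwich[rs]; elim: rs => //= r rs IHrs /H; exact: IHrs.
Qed.

Hypothesis K_inf : infinite_type K.

(** C is trivially nilpotent modulo (com), and com is negligible; hence c C^N lies in C^(N+1) for
    some nonzero c. Writing C^(N+k) as C^N C^k allows this to be iterated. *)
Lemma cpow_collapse : exists N, forall k, exists c : K, c != 0 /\
  forall u, cpow N u -> cpow (N + k) (c *: u).
Proof.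
have Qcom : negligible com.
  apply: (@Rad_commutator K A K_inf negligible negligible0 negligibleD _ _
            negligible_saturated negligible_semiprime n engelA y x).
  - by move=> u v Qv; rewrite -[u * v]mulr1; exact: negligibleM.
  - by move=> u v Qu; rewrite -[u]mul1r; exact: negligibleM.
have [|N [c [c0 H]]] := Qcom [::].
  exists 1%N, 1; rewrite oner_neq0; split=> // u; rewrite scale1r.
  by apply: span_sub => _ [p [t [_ ->]]]; apply: span_in; left; exists p, com, t; rewrite inE eqxx.
have {}H u : cpow N u -> cpow N.+1 (c *: u).
  move=> /H; elim=> [|v w _ Hv _ Hw|v [[s [h [t []]]]|]] //; first exact: span0.
  exact: cpowD.
exists N; elim=> [|k [d [d0 Hd]]].
  by exists 1; rewrite oner_neq0; split=> // u; rewrite addn0 scale1r.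
exists (c * d); rewrite mulf_neq0 //; split=> // u /Hd /cpow_split; rewrite -scalerA addnS.
apply: (@span_map _ _ _ _ (fun w => c *: w)) => [|v w|_ [p [q [Np kq ->]]]].
- by rewrite scaler0.
- by rewrite scalerDr.
by rewrite scalerAl; exact: (cpowM (H _ Np) kq).
Qed.

(** * The graded case: nilpotency of C and the Morse identity *)

Hypothesis torsion_freeA : torsion_free A.
Variable Hom : nat -> A -> Prop.
Hypotheses (Hom1 : Hom 0 1) (Homx : Hom 1 x) (Homy : Hom 1 y).
Hypothesis HomD : forall d u v, Hom d u -> Hom d v -> Hom d (u + v).
Hypothesis HomZ : forall d (c : K) u, Hom d u -> Hom d (c *: u).
Hypothesis HomM : forall d e u v, Hom d u -> Hom e v -> Hom (d + e) (u * v).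
Hypothesis Hom_indep : forall d u, Hom d u ->
  span (fun v => exists e, (d < e)%N /\ Hom e v) u -> u = 0.

(** A is spanned by homogeneous elements, and each factor com adds 2 to the degree. *)
Lemma cpow_homogeneous k u : cpow k u ->
  span (fun v => exists d, [/\ (k.*2 <= d)%N, Hom d v & cpow k v]) u.
Proof.
pose S k := span (fun v => exists d, [/\ (k.*2 <= d)%N, Hom d v & cpow k v]).
have S0 w : S 0%N w.
  apply: generated w => [|||v w|c w|v w].
  - by apply: span_in; exists 0%N.
  - by apply: span_in; exists 1%N.
  - by apply: span_in; exists 1%N.
  - exact: spanD.
  - apply: (@span_map _ _ _ _ (fun w => c *: w)) => [|a b|a [d [_ Ha _]]].
    + by rewrite scaler0.
    + by rewrite scalerDr.
    by apply: span_in; exists d; split=> //; exact: HomZ.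
  apply: span_mul => a b [d [_ Ha _]] [e [_ Hb _]].
  by apply: span_in; exists (d + e)%N; split=> //; exact: HomM.
have Homcom : Hom 2 com.
  by rewrite /com -scaleN1r; apply: HomD; [|apply: HomZ]; apply: (@HomM 1 1).
elim: k u => [|k IHk] u; first by move=> _; exact: S0.
apply: span_sub => _ [p [t [/IHk Sp ->]]].
have Spc : span (fun v => exists d a, [/\ v = a * com, (k.*2 <= d)%N, Hom d a & cpow k a]) (p * com).
  move: Sp; apply: (@span_map _ _ _ _ (fun w => w * com)) => [|a b|a [d [ld Ha ka]]].
  - by rewrite mul0r.
  - by rewrite mulrDl.
  by apply: span_in; exists d, a.
move: Spc (S0 t); apply: span_mul => _ b [d [a [-> ld Ha ka]]] [e [_ Hb _]].
apply: span_in; exists (d + 2 + e)%N; split.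
- by rewrite doubleS; lia.
- by apply: HomM => //; exact: HomM.
- by apply: span_in; exists a, b.
Qed.

(** For u in C^N homogeneous of degree d, a nonzero multiple of u lies in C^(N+d+1), whose
    homogeneous components have degree greater than d. So that multiple is 0, and u = 0 by
    torsion-freeness. *)
Lemma cpow_eq0 : exists N, forall u, cpow N u -> u = 0.
Proof.
have [N H] := cpow_collapse; exists N => u /cpow_homogeneous.
elim=> [//|v w _ -> _ ->|v [d [_ Hv Nv]]]; first by rewrite addr0.
have [c [c0 /(_ _ Nv) /cpow_homogeneous Hc]] := H d.+1.
case: (torsion_freeA (a := c) (x := v)) => [|/eqP|//]; last by rewrite (negPf c0).
apply: (@Hom_indep d); first exact: HomZ.
move: Hc; apply: span_sub => w [e [le He _]]; apply: span_in; exists e; split=> //.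
by lia.
Qed.

Lemma morse_pair_eq a b : exists k, (morse_pair a b k).1 = (morse_pair a b k).2.
Proof.
pose U k := (morse_pair a b k).1; pose V k := (morse_pair a b k).2; pose t := a * b.
have US k : U k.+1 = U k * V k by rewrite /U /V /=; case: (morse_pair a b k).
have VS k : V k.+1 = V k * U k by rewrite /U /V /=; case: (morse_pair a b k).
have dS k : U k.+1 - V k.+1 = ad (U k) (U k - V k).
  by rewrite US VS /ad mulrBl mulrBr opprB [RHS]addrC subrKA.
have d1 k : cpow 1 (U k - V k).
  case: k => [|k]; last by rewrite dS; exact: cpow_ad.
  by have := cpow_ad a b; rewrite /ad.
have Ut k : cpow 1 (U k - t ^+ (2 ^ k)).
  elim: k => [|k IHk]; first by rewrite expn0 expr1 subrr; exact: cpow_0.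
  have -> : U k.+1 - t ^+ (2 ^ k.+1) =
      U k * (U k - t ^+ (2 ^ k)) + (U k - t ^+ (2 ^ k)) * t ^+ (2 ^ k) - U k * (U k - V k).
    rewrite US expnSr exprM expr2 !mulrBr mulrBl.
    by rewrite subrKA opprB [RHS]addrC subrKA.
  by apply: cpowB; [apply: cpowD; [exact: cpowMl | exact: cpowMr] | exact: cpowMl].
(* If U k - V k lies in C^j, then modulo C^(j+1) each further doubling takes one [ad t] out of the
   difference; after n of them the Engel identity makes it 0. *)
have step j k : cpow j (U k - V k) -> exists k', cpow j.+1 (U k' - V k').
  move=> jk.
  suff H i : exists w, cpow j w /\ cpow j.+1 (U (i + k)%N - V (i + k)%N - iter i (ad t) w).
    by have [w [_ Hw]] := H n; exists (n + k)%N; move: Hw; rewrite engelA subr0.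
  elim: i => [|i [w [jw Hw]]]; first by exists (U k - V k); rewrite subrr; split=> //; exact: cpow_0.
  set m := (2 ^ (i + k))%N.
  (* By [ad_pow], [ad t] maps this sum to ad (t^m) w, which supplies the next factor [ad t]. *)
  exists (\sum_(l < m) t ^+ l * w * t ^+ (m.-1 - l)); split.
    by apply: cpow_sum => l _; apply: cpowMr; exact: cpowMl.
  have comm e v : ad (t ^+ m) (iter e (ad t) v) = iter e (ad t) (ad (t ^+ m) v).
    elim: e => //= e <-; apply: ad_comm; exact/esym/commrX.
  have adl (u v c : A) : ad (u - v) c = ad u c - ad v c.
    by rewrite /ad mulrBr mulrBl opprD opprK opprB addrACA [- _ + _]addrC.
  have -> : U (i.+1 + k)%N - V (i.+1 + k)%N -
      iter i.+1 (ad t) (\sum_(l < m) t ^+ l * w * t ^+ (m.-1 - l)) =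
      ad (U (i + k)%N) (U (i + k)%N - V (i + k)%N - iter i (ad t) w) +
      ad (U (i + k)%N - t ^+ m) (iter i (ad t) w).
    rewrite addSn dS iterSr -ad_pow -comm [ad _ (_ - iter _ _ _)]adD adN adl.
    by rewrite addrA subrK.
  apply: cpowD; first by apply: cpowB; [exact: cpowMr | exact: cpowMl].
  have jw' : cpow j (iter i (ad t) w).
    by elim: i {m Hw comm} => //= i IHi; apply: cpowB; [exact: cpowMr | exact: cpowMl].
  apply: cpowB; first by rewrite -addn1; exact: cpowM.
  by rewrite -add1n; exact: cpowM.
have [N HN] := cpow_eq0.
have [k /HN /eqP] : exists k, cpow N (U k - V k).
  elim: N {HN} => [|j [k Hk]]; first by exists 0%N.
  exact: step Hk.
by rewrite subr_eq0 => /eqP Uk; exists k.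
Qed.

End CommutatorIdeal.

(** * The unitization of an algebra *)

Section Unitization.
Variables (K : comNzRingType) (V : lmodType K) (mul : V -> V -> V).

(** Carrying H in the type lets the ring instances, whose axioms rest on H, be attached to it; [K^o]
    is K as a module over itself. *)
Definition unitization (H : nu_algebra mul) : Type := (K^o * V)%type.

Variable H : nu_algebra mul.
Notation U := (unitization H).

HB.instance Definition _ := GRing.Lmodule.copy U (K^o * V)%type.

Definition unitization_mul (u v : U) : U :=
  (u.1 * v.1, u.1 *: v.2 + v.1 *: u.2 + mul u.2 v.2).
Definition unitization_one : U := (1, 0).

Let mulDl : left_distributive mul +%R. Proof. by case: H. Qed.
Let mulDr : right_distributive mul +%R. Proof. by case: H. Qed.
Let mulZl (a : K) x y : mul (a *: x) y = a *: mul x y. Proof. by case: H. Qed.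
Let mulZr (a : K) x y : mul x (a *: y) = a *: mul x y. Proof. by case: H. Qed.
Let mul0 x : mul 0 x = 0. Proof. by have := mulZl 0 0 x; rewrite !scale0r. Qed.
Let mulx0 x : mul x 0 = 0. Proof. by have := mulZr 0 x 0; rewrite !scale0r. Qed.

Lemma unitization_mulA : associative unitization_mul.
Proof.
have mulA : associative mul by case: H.
move=> [a x] [b y] [c z]; rewrite /unitization_mul /=; congr (_, _); first exact: mulrA.
rewrite !mulDl !mulDr !mulZl !mulZr mulA !scalerDr !scalerA.
rewrite -!addrA; congr (_ + _); rewrite [c * a]mulrC [c * b]mulrC; congr (_ + _).
rewrite addrCA; congr (_ + _).
by rewrite [RHS]addrCA; congr (_ + _); rewrite addrCA.
Qed.

Lemma unitization_mul1l : left_id unitization_one unitization_mul.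
Proof.
by case=> [a x]; rewrite /unitization_mul /= mul1r scale1r scaler0 mul0 !addr0.
Qed.

Lemma unitization_mul1r : right_id unitization_one unitization_mul.
Proof.
by case=> [a x]; rewrite /unitization_mul /= mulr1 scale1r scaler0 mulx0 add0r addr0.
Qed.

Lemma unitization_mulDl : left_distributive unitization_mul +%R.
Proof.
move=> [a x] [b y] [c z]; rewrite /unitization_mul /=; congr (_, _); first exact: mulrDl.
by rewrite mulDl scalerDr scalerDl /= (addrACA (a *: z)) [LHS]addrACA.
Qed.

Lemma unitization_mulDr : right_distributive unitization_mul +%R.
Proof.
move=> [a x] [b y] [c z]; rewrite /unitization_mul /=; congr (_, _); first exact: mulrDr.
by rewrite mulDr scalerDr scalerDl /= (addrACA (a *: y)) [LHS]addrACA.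
Qed.

Lemma unitization_one_neq0 : unitization_one != 0.
Proof. by apply/eqP => -[/eqP]; rewrite oner_eq0. Qed.

HB.instance Definition _ := GRing.Zmodule_isNzRing.Build U unitization_mulA
  unitization_mul1l unitization_mul1r unitization_mulDl unitization_mulDr unitization_one_neq0.

Lemma unitization_scalerAl (a : K) (u v : U) : a *: (u * v) = a *: u * v.
Proof.
case: u v => [b x] [c y]; congr (_, _); rewrite /=; first exact: mulrA.
by rewrite mulZl !scalerDr !scalerA [a * c]mulrC.
Qed.

HB.instance Definition _ := GRing.Lmodule_isLalgebra.Build K U unitization_scalerAl.

Lemma unitization_scalerAr (a : K) (u v : U) : a *: (u * v) = u * (a *: v).
Proof.
case: u v => [b x] [c y]; congr (_, _); rewrite /=; first exact: mulrCA.
by rewrite mulZr !scalerDr !scalerA [a * b]mulrC.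
Qed.

HB.instance Definition _ := GRing.Lalgebra_isAlgebra.Build K U unitization_scalerAr.

Definition emb (x : V) : U := (0, x).

Lemma embM x y : emb (mul x y) = emb x * emb y.
Proof. by congr (_, _); rewrite /= ?mul0r // !scale0r !add0r. Qed.
Lemma embD x y : emb (x + y) = emb x + emb y.
Proof. by congr (_, _); rewrite /= ?addr0. Qed.
Lemma embN x : emb (- x) = - emb x.
Proof. by congr (_, _); rewrite /= ?oppr0. Qed.
Lemma emb0 : emb 0 = 0. Proof. by []. Qed.
Lemma embZ (a : K) x : emb (a *: x) = a *: emb x.
Proof. by congr (_, _); rewrite /= ?scaler0. Qed.
Lemma emb_inj : injective emb. Proof. by move=> x y []. Qed.

End Unitization.

(** * Algebras of functions *)

Section FunctionAlgebra.
Variables (K : comNzRingType) (T : Type) (B : algType K).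

(** The point t0 is part of the type because 1 differs from 0 only when T is inhabited. *)
Definition funalg (t0 : T) : Type := T -> B.
Variable t0 : T.
Notation F := (funalg t0).
HB.instance Definition _ := GRing.PzRing.copy F (T -> B).
HB.instance Definition _ := GRing.Lmodule.copy F (T -> B).

Lemma funalg_one_neq0 : 1 != 0 :> F.
Proof. by apply/eqP => /(congr1 (fun f : F => f t0)) /eqP; rewrite oner_eq0. Qed.
HB.instance Definition _ := GRing.PzSemiRing_isNonZero.Build F funalg_one_neq0.

Lemma funalg_scalerAl (a : K) (f g : F) : a *: (f * g) = a *: f * g.
Proof. by apply/funext => t; exact: scalerAl. Qed.
HB.instance Definition _ := GRing.Lmodule_isLalgebra.Build K F funalg_scalerAl.
Lemma funalg_scalerAr (a : K) (f g : F) : a *: (f * g) = f * (a *: g).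
Proof. by apply/funext => t; exact: scalerAr. Qed.
HB.instance Definition _ := GRing.Lalgebra_isAlgebra.Build K F funalg_scalerAr.

End FunctionAlgebra.

(** * The subalgebra generated by two elements *)

Section GeneratedSubalgebra.
Variables (K : comNzRingType) (F : algType K) (x y : F).

Inductive generated : F -> Prop :=
| generated1 : generated 1
| generatedx : generated x
| generatedy : generated y
| generatedD u v : generated u -> generated v -> generated (u + v)
| generatedZ (c : K) u : generated u -> generated (c *: u)
| generatedM u v : generated u -> generated v -> generated (u * v).

Definition generated_pred : {pred F} := fun u => `[<generated u>].

Lemma generated_subsemialg : GRing.subsemialg_closed generated_pred.
Proof.
split=> [|||u v /asboolP gu /asboolP gv]; last by apply/asboolP; exact: generatedM.
- by apply/asboolP; exact: generated1.
- split=> [|u v /asboolP gu /asboolP gv]; apply/asboolP; last exact: generatedD.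
  by rewrite -(scale0r 1); apply: generatedZ; exact: generated1.
- by move=> c u /asboolP gu; apply/asboolP; exact: generatedZ.
Qed.

Definition subalg2 : Type := {u : F | u \in generated_pred}.
HB.instance Definition _ := SubChoice.copy subalg2 {u : F | u \in generated_pred}.
HB.instance Definition _ :=
  GRing.SubChoice_isSubAlgebra.Build K F generated_pred subalg2 generated_subsemialg.

Definition subalg2_x : subalg2 := exist _ x (asboolT generatedx).
Definition subalg2_y : subalg2 := exist _ y (asboolT generatedy).

Lemma subalg2_ind (S : subalg2 -> Prop) :
    S 1 -> S subalg2_x -> S subalg2_y -> (forall u v, S u -> S v -> S (u + v)) ->
    (forall (c : K) u, S u -> S (c *: u)) ->
    (forall u v, S u -> S v -> S (u * v)) ->
  forall u, S u.
Proof.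
move=> S1 Sx Sy SD SZ SM u.
suff H f : generated f -> exists2 v : subalg2, val v = f & S v.
  by have /asboolP/H[v /val_inj <-] := valP u.
elim=> [|||a b _ [a' <- Sa] _ [b' <- Sb]|c a _ [a' <- Sa]|a b _ [a' <- Sa] _ [b' <- Sb]].
- by exists 1 => //; rewrite rmorph1.
- by exists subalg2_x.
- by exists subalg2_y.
- by exists (a' + b'); [rewrite rmorphD | exact: SD].
- by exists (c *: a'); [rewrite linearZ | exact: SZ].
- by exists (a' * b'); [rewrite rmorphM | exact: SM].
Qed.

End GeneratedSubalgebra.

Lemma morse_pair_morph (A B : nzRingType) (f : A -> B) a b k :
  {morph f : u v / u * v} ->
  morse_pair (f a) (f b) k = (f (morse_pair a b k).1, f (morse_pair a b k).2).
Proof.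
move=> fM; elim: k => [|k IHk] /=; first by rewrite !fM.
by rewrite IHk; case: (morse_pair a b k) => u v /=; rewrite !fM.
Qed.

(** * From the Engel identity to equal Morse pairs *)

Section EngelMorse.
Variables (K : idomainType) (V : lmodType K) (mul : V -> V -> V) (Halg : nu_algebra mul).
Hypotheses (K_inf : infinite_type K) (Htf : torsion_free V).
Notation U := (unitization Halg).
Local Notation emb := (emb Halg).

Lemma unitization_torsion_free : torsion_free U.
Proof.
move=> c [a x] [/eqP]; rewrite mulf_eq0 => /orP[/eqP|/eqP ->]; first by left.
by move=> /Htf[|->]; [left | right].
Qed.

Lemma ad_emb x y : ad (emb y) (emb x) = emb (lie_comm mul x y).
Proof. by rewrite /ad -!embM -embN -embD. Qed.

Lemma iter_ad_emb n x y : iter n (ad (emb y)) (emb x) = emb (engel mul n x y).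
Proof. by elim: n => //= n ->; rewrite ad_emb. Qed.

Lemma unitization_decomp (u : U) : u = u.1%:A + emb u.2.
Proof.
case: u => a x; transitivity ((a * 1 + 0, a *: 0 + x) : U) => //.
by rewrite mulr1 addr0 scaler0 add0r.
Qed.

(** Scalars are central, so the scalar part of v never contributes and that of u disappears at the
    first commutator, which is why n is positive. *)
Lemma iter_ad_unitization n (u v : U) : (0 < n)%N ->
  iter n (ad v) u = emb (engel mul n u.2 v.2).
Proof.
move=> n_gt0.
have adE (w : U) : ad v w = ad (emb v.2) w.
  rewrite {1}(unitization_decomp v) /ad mulrDl mulrDr -scalerAl -scalerAr mul1r mulr1.
  by rewrite opprD addrACA subrr add0r.
rewrite (eq_iter adE) [u in LHS]unitization_decomp adnD iter_ad_emb.
case: n n_gt0 => // n _; have ad_scalar : ad (emb v.2) u.1%:A = 0.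
  by rewrite /ad -scalerAl -scalerAr mul1r mulr1 subrr.
by rewrite iterSr ad_scalar adn0 add0r.
Qed.

Let F := funalg U ((0, 0) : V * V).
Let X : F := fun p => emb p.1.
Let Y : F := fun p => emb p.2.
Let A : algType K := subalg2 X Y.
Let ev (p : V * V) (u : A) : U := (val u : F) p.

Let evD p : {morph ev p : u v / u + v}. Proof. by move=> u v; rewrite /ev rmorphD. Qed.
Let evB p : {morph ev p : u v / u - v}. Proof. by move=> u v; rewrite /ev rmorphB. Qed.
Let evM p : {morph ev p : u v / u * v}. Proof. by move=> u v; rewrite /ev rmorphM. Qed.
Let ev1 p : ev p 1 = 1. Proof. by rewrite /ev rmorph1. Qed.
Let ev0 p : ev p 0 = 0. Proof. by rewrite /ev raddf0. Qed.
Let evZ p (c : K) u : ev p (c *: u) = c *: ev p u. Proof. by rewrite /ev linearZ. Qed.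
Let ev_inj u v : (forall p, ev p u = ev p v) -> u = v.
Proof. by move=> H; apply: val_inj; apply/funext => p; exact: H. Qed.

(** The elements of A are functions rather than formal polynomials, so degree is defined by scaling
    the arguments. *)
Let Hom d (u : A) := forall (c : K) p, ev (c *: p) u = c ^+ d *: ev p u.

Let Hom0 d : Hom d 0. Proof. by move=> c p; rewrite !ev0 scaler0. Qed.

Let Hom_span d u : span (fun v => exists e, (d < e)%N /\ Hom e v) u ->
  exists m (f : nat -> A), (forall i, Hom (d.+1 + i)%N (f i)) /\ u = \sum_(i < m) f i.
Proof.
have pad m m' (f : nat -> A) : (m <= m')%N ->
    \sum_(i < m) f i = \sum_(i < m') (if (i < m)%N then f i else 0).
  move=> mm; rewrite -(big_mkord xpredT f) -(big_mkord xpredT (fun i => if (i < m)%N then f i else 0)).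
  rewrite (big_cat_nat (leq0n m) mm) /= [X in _ = _ + X]big1_seq ?addr0 => [|i].
    by apply: eq_big_nat => i /andP[_ ->].
  by rewrite mem_index_iota => /andP[_ /andP[mi _]]; rewrite ltnNge mi.
elim=> [|v w _ [m [f [Hf ->]]] _ [m' [g [Hg ->]]]|v [e [de He]]].
- by exists 0%N, (fun=> 0); rewrite big_ord0.
- exists (maxn m m'), (fun i => (if (i < m)%N then f i else 0) + (if (i < m')%N then g i else 0)).
  split=> [i c p|].
    by rewrite !evD scalerDr; congr (_ + _); case: ifP => _; rewrite ?Hf ?Hg // !ev0 scaler0.
  by rewrite (pad m (maxn m m')) ?leq_maxl // (pad m' (maxn m m')) ?leq_maxr // big_split.
exists (e - d)%N, (fun i => if i == (e - d.+1)%N then v else 0); split=> [i|].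
  case: eqP => [->|_]; last exact: Hom0.
  by rewrite subnKC.
have lt : (e - d.+1 < e - d)%N by rewrite subnS prednK // subn_gt0.
by rewrite (bigD1 (Ordinal lt)) //= eqxx big1 ?addr0 // => i /negPf; rewrite -val_eqE /= => ->.
Qed.

(** At the point c p the equation becomes a polynomial relation in c with coefficient u(p) at c^d;
    interpolation makes this coefficient vanish. *)
Let Hom_indep d u : Hom d u ->
  span (fun v => exists e, (d < e)%N /\ Hom e v) u -> u = 0.
Proof.
move=> Hu /Hom_span[m [f [Hf uE]]]; apply: ev_inj => p; rewrite ev0.
pose g j := if (j < d)%N then 0 else if j == d then ev p u else - ev p (f (j - d.+1)%N).
have -> : ev p u = g d by rewrite /g ltnn eqxx.
apply: (coef_of_evaluations K_inf (P := fun u : U => u = 0) (m := (d.+1 + m)%N) (f := g)) => //.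
- by move=> a b -> ->; rewrite addr0.
- by move=> c a ->; rewrite scaler0.
- by move=> c a c0 /unitization_torsion_free[/eqP|//]; rewrite (negPf c0).
- move=> c; rewrite big_split_ord /= big_ord_recr /= big1 => [|i _]; last first.
    by rewrite /g ltn_ord scaler0.
  rewrite add0r {1}/g ltnn eqxx -Hu uE (big_morph _ (evD _) (ev0 _)) -big_split /=.
  apply: big1 => i _.
  rewrite /g /= ltnNge (leq_trans (leqnSn d) (leq_addr _ _)) /= gtn_eqF ?leq_addr // addKn.
  by rewrite Hf scalerN subrr.
by rewrite leq_addr.
Qed.

(** The equality is proved once, for the generic pair in A, and then evaluated at (a, b); this makes
    k uniform. *)
Lemma engel_morse_pair n : (0 < n)%N -> (forall x y, engel mul n x y = 0) ->
  exists k, forall x y : V,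
    (morse_pair (1 + emb x) (1 + emb y) k).1 = (morse_pair (1 + emb x) (1 + emb y) k).2.
Proof.
move=> n_gt0 engelV.
have engelA (u v : A) : iter n (ad v) u = 0.
  apply: ev_inj => p; rewrite ev0; transitivity (iter n (ad (ev p v)) (ev p u)).
    by elim: n {n_gt0 engelV} => //= n <-; rewrite /ad evB !evM.
  by rewrite iter_ad_unitization // engelV emb0.
have tfA : torsion_free A.
  move=> c u cu; case: (eqVneq c 0) => [->|c0]; [by left | right].
  apply: ev_inj => p; rewrite ev0.
  have := congr1 (ev p) cu; rewrite evZ ev0 => /unitization_torsion_free[/eqP|//].
  by rewrite (negPf c0).
pose x : A := subalg2_x X Y; pose y : A := subalg2_y X Y.
have [] := @morse_pair_eq K A x y (@subalg2_ind K F X Y) n engelA K_inf tfA Hom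
  _ _ _ _ _ _ Hom_indep (1 + x) (1 + y).
- by move=> c p; rewrite !ev1 expr0 scale1r.
- by move=> c p; rewrite expr1 /ev /= /X embZ.
- by move=> c p; rewrite expr1 /ev /= /Y embZ.
- by move=> d u v Hu Hv c p; rewrite !evD scalerDr Hu Hv.
- by move=> d a u Hu c p; rewrite !evZ Hu !scalerA mulrC.
- by move=> d e u v Hu Hv c p; rewrite !evM Hu Hv -scalerAl -scalerAr scalerA exprD.
move=> k kE; exists k => a b.
have /= -> : morse_pair (1 + emb a) (1 + emb b) k = (ev (a, b) (morse_pair (1 + x) (1 + y) k).1,
    ev (a, b) (morse_pair (1 + x) (1 + y) k).2).
  by rewrite -(morse_pair_morph _ _ _ (evM (a, b))) !evD !ev1.
by rewrite kE.
Qed.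

End EngelMorse.

(** * Reduced cores of pairs of words *)

Lemma strip_common_prefix (T : eqType) (x0 : T) (u v : seq T) : size u = size v -> u != v ->
  exists p u' v', [/\ u = p ++ u', v = p ++ v', size u' = size v', u' != [::] & head x0 u' != head x0 v'].
Proof.
elim: u v => [|a u IHu] [|b v] //= [suv]; rewrite eqseq_cons negb_and.
case: (eqVneq a b) => [<- /= /(IHu _ suv)[p [u' [v' [-> -> ? ? ?]]]]|ab _].
  by exists (a :: p), u', v'.
by exists [::], (a :: u), (b :: v); split=> //=; rewrite suv.
Qed.

(** The common prefix is stripped first, then, after reversal, the common suffix; equal lengths keep
    both cores nonempty. *)
Lemma reduced_core (u v : seq nat) : size u = size v -> u != v ->
  exists p s u' v', [/\ u = p ++ u' ++ s, v = p ++ v' ++ s, size u' = size v', u' != [::] & reduced_words u' v'].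
Proof.
move=> suv uv; have [p [u1 [v1 [-> -> s1 u10 h1]]]] := strip_common_prefix 0%N suv uv.
have [||s [u2 [v2 [E1 E2 s2 u20 h2]]]] := @strip_common_prefix _ 0%N (rev u1) (rev v1).
- by rewrite !size_rev.
- by apply: contraNneq h1 => /(congr1 rev); rewrite !revK => ->.
have {E1} E1 : u1 = rev u2 ++ rev s by rewrite -rev_cat -E1 revK.
have {E2} E2 : v1 = rev v2 ++ rev s by rewrite -rev_cat -E2 revK.
exists p, (rev s), (rev u2), (rev v2); rewrite -E1 -E2 !size_rev; split=> //.
  by rewrite -size_eq0 size_rev size_eq0.
have v20 : v2 != [::] by rewrite -size_eq0 -s2 size_eq0.
rewrite /reduced_words; case: u2 v2 u20 v20 h2 E1 E2 {s2} => [|a u2] [|b v2] //= _ _ h2 E1 E2.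
rewrite !rev_cons !last_rcons h2 andbT.
move: h1; rewrite E1 E2 !rev_cons.
by case: (rev u2) (rev v2) => [|? ?] [|? ?].
Qed.

(** * Polynomials determined by their values at scalars *)

Section PolyEvaluations.
Variables (K : idomainType) (B : algType K).
Hypotheses (K_inf : infinite_type K) (tfB : torsion_free B).

Lemma comm_poly_alg (p : {poly B}) (c : K) : comm_poly p c%:A.
Proof. by rewrite /comm_poly mulr_algl mulr_algr. Qed.

Lemma poly_eq0_of_evaluations (p : {poly B}) : (forall c : K, p.[c%:A] = 0) -> p = 0.
Proof.
move=> H; apply/polyP => i; rewrite coef0.
case: (ltnP i (size p)) => [ip|pi]; last exact: nth_default.
apply: (coef_of_evaluations K_inf (P := fun u : B => u = 0) (m := size p) (f := fun i => p`_i)) => //.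
- by move=> a b -> ->; rewrite addr0.
- by move=> c a ->; rewrite scaler0.
- by move=> c a c0 /tfB[/eqP|//]; rewrite (negPf c0).
move=> c; rewrite -[RHS](H c) horner_coef; apply: eq_bigr => j _.
by rewrite exprZn expr1n mulr_algr.
Qed.

(** A polynomial with constant term 1 is invertible as a power series; here the coefficients of q
    are killed by induction. *)
Lemma mul_eq0_const1l (p q : {poly B}) : p`_0 = 1 -> p * q = 0 -> q = 0.
Proof.
move=> p0 pq; apply/polyP => i; rewrite coef0; elim/ltn_ind: i => i IHi.
have := congr1 (fun r : {poly B} => r`_i) pq; rewrite coef0 coefM big_ord_recl /= p0 mul1r subn0.
by rewrite big1 ?addr0 // => j _; rewrite IHi ?mulr0 // /bump /= add1n subnSK // leq_subr.
Qed.

Lemma mul_eq0_const1r (p q : {poly B}) : q`_0 = 1 -> p * q = 0 -> p = 0.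
Proof.
move=> q0 pq; apply/polyP => i; rewrite coef0; elim/ltn_ind: i => i IHi.
have := congr1 (fun r : {poly B} => r`_i) pq; rewrite coef0 coefM big_ord_recr /= subnn q0 mulr1.
by rewrite big1 ?add0r // => j _; rewrite IHi ?mul0r.
Qed.

Definition circ_poly (f : nat -> B) (w : seq nat) : {poly B} := \prod_(i <- w) (1 + (f i)%:P * 'X).

Lemma circ_poly_cat f u v : circ_poly f (u ++ v) = circ_poly f u * circ_poly f v.
Proof. exact: big_cat. Qed.

Lemma coef_circ_poly_cons f a w k : (circ_poly f (a :: w))`_k =
  (circ_poly f w)`_k + f a * (if k is j.+1 then (circ_poly f w)`_j else 0).
Proof.
rewrite /circ_poly big_cons mulrDl mul1r coefD -mulrA coefCM coefXM; congr (_ + _ * _).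
by case: k.
Qed.

Lemma circ_poly_coef0 f w : (circ_poly f w)`_0 = 1.
Proof.
elim: w => [|a w IHw]; first by rewrite /circ_poly big_nil coef1.
by rewrite coef_circ_poly_cons IHw mulr0 addr0.
Qed.

Lemma circ_poly_coef_big f w k : (size w < k)%N -> (circ_poly f w)`_k = 0.
Proof.
elim: w k => [|a w IHw] [|k] //= wk; first by rewrite /circ_poly big_nil coef1.
by rewrite coef_circ_poly_cons !IHw ?mulr0 ?addr0 // ltnW.
Qed.

Lemma circ_poly_lead f w : (circ_poly f w)`_(size w) = \prod_(i <- w) f i.
Proof.
elim: w => [|a w IHw]; first by rewrite /circ_poly !big_nil coef1.
by rewrite coef_circ_poly_cons circ_poly_coef_big //= IHw add0r big_cons.
Qed.

Lemma horner_circ_poly f w (c : K) :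
  (circ_poly f w).[c%:A] = \prod_(i <- w) (1 + c *: f i).
Proof.
elim: w => [|a w IHw]; first by rewrite /circ_poly !big_nil hornerC.
rewrite /circ_poly !big_cons hornerM_comm; last exact: comm_poly_alg.
by rewrite IHw hornerD hornerMX !hornerC mulr_algr.
Qed.

End PolyEvaluations.

(** Linear forms substituted into a binary form of degree n give one of degree n. The coefficients c
    do not depend on X and Y, so that [yxy_to_engel] can use them at two different pairs (X, Y). *)
Lemma homogeneous_coefs (R : comNzRingType) (a1 a2 b1 b2 : R) (al : nat -> R) n :
  exists c : nat -> R, forall X Y : R,
    \sum_(i < n.+1) al i * (a1 * X + a2 * Y) ^+ i * (b1 * X + b2 * Y) ^+ (n - i) =
    \sum_(j < n.+1) c j * X ^+ j * Y ^+ (n - j).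
Proof.
pose homog m (g : R -> R -> R) := exists c : nat -> R, forall X Y,
  g X Y = \sum_(j < m.+1) c j * X ^+ j * Y ^+ (m - j).
have homogM m a b g : homog m g -> homog m.+1 (fun X Y => (a * X + b * Y) * g X Y).
  move=> [c gE]; exists (fun j => (if j is j'.+1 then a * c j' else 0) + (if (j <= m)%N then b * c j else 0)).
  move=> X Y; rewrite gE mulrDl; under [RHS]eq_bigr do rewrite !mulrDl.
  rewrite big_split /=; congr (_ + _).
    rewrite [RHS]big_ord_recl /= !mul0r add0r mulr_sumr; apply: eq_bigr => i _.
    by rewrite /bump /= add1n subSS exprS; ring.
  rewrite [RHS]big_ord_recr /= ltnn !mul0r addr0 mulr_sumr; apply: eq_bigr => i _.
  by have im : (i <= m)%N := ltn_ord i; rewrite im subSn // exprS; ring.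
have homogX i a b m g : homog m g -> homog (i + m)%N (fun X Y => (a * X + b * Y) ^+ i * g X Y).
  move=> Hg; elim: i => [|i [c cE]].
    by case: Hg => c cE; exists c => X Y; rewrite expr0 mul1r cE.
  have [|d dE] := @homogM (i + m)%N a b (fun X Y => (a * X + b * Y) ^+ i * g X Y).
    by exists c.
  by exists d => X Y; rewrite exprS -mulrA dE.
have homog1 : homog 0%N (fun _ _ => 1) by exists (fun=> 1) => X Y; rewrite big_ord1 !expr0 !mulr1.
suff H r : {in r, forall i, (i <= n)%N} -> homog n (fun X Y =>
    \sum_(i <- r) al i * (a1 * X + a2 * Y) ^+ i * (b1 * X + b2 * Y) ^+ (n - i)).
  have [|c cE] := H (iota 0 n.+1); first by move=> i; rewrite mem_iota ltnS.
  by exists c => X Y; rewrite -cE -[iota _ _]/(index_iota 0 n.+1) big_mkord.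
elim: r => [|i r IHr] rn.
  by exists (fun=> 0) => X Y; rewrite big_nil big1 // => j _; rewrite !mul0r.
have [|c cE] := IHr; first by move=> j jr; apply: rn; rewrite inE jr orbT.
have [d dE] := homogX i a1 a2 _ _ (homogX (n - i)%N b1 b2 _ _ homog1).
exists (fun j => al i * d j + c j) => X Y; rewrite big_cons cE.
under [RHS]eq_bigr do rewrite !mulrDl.
rewrite big_split /=; congr (_ + _).
have := dE X Y; rewrite addn0 subnKC; last by apply: rn; rewrite inE eqxx.
rewrite mulr1 -mulrA => ->; rewrite mulr_sumr; apply: eq_bigr => j _.
by rewrite !mulrA.
Qed.

(** * The implications between the identities *)

Section Words.
Variables (K : idomainType) (V : lmodType K) (mul : V -> V -> V) (Halg : nu_algebra mul).
Hypotheses (K_inf : infinite_type K) (Htf : torsion_free V).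
Notation U := (unitization Halg).
Local Notation emb := (emb Halg).
Let tfU := unitization_torsion_free (Halg := Halg) Htf.

Lemma emb_weval f w : w != [::] -> emb (weval mul f w) = \prod_(i <- w) emb (f i).
Proof.
case: w => //= a w _; rewrite big_cons; elim: w (f a) => [|b w IHw] x /=.
  by rewrite big_nil mulr1.
by rewrite IHw embM big_cons mulrA.
Qed.

Lemma emb_circ x y : 1 + emb (circ mul x y) = (1 + emb x) * (1 + emb y).
Proof.
rewrite /circ !embD embM mulrDl mul1r mulrDr mulr1 !addrA; congr (_ + _).
by rewrite addrAC.
Qed.

Lemma emb_weval_circ f w : w != [::] ->
  1 + emb (weval (circ mul) f w) = \prod_(i <- w) (1 + emb (f i)).
Proof.
case: w => //= a w _; rewrite big_cons; elim: w (f a) => [|b w IHw] x /=.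
  by rewrite big_nil mulr1.
by rewrite IHw emb_circ big_cons mulrA.
Qed.

(** x u y = y u x is a reduced identity, both sides being 0. *)
Lemma reduced_of_zero_word u : (forall f : nat -> V, \prod_(i <- u) emb (f i) = 0) ->
  satisfies_reduced_sg_identity mul.
Proof.
move=> u0; exists (0%N :: u ++ [:: 1%N]), (1%N :: u ++ [:: 0%N]).
rewrite /reduced_words /= !last_cat /=; split=> //; split=> // f; apply: (@emb_inj _ _ _ Halg).
by rewrite !emb_weval // !big_cons !big_cat /= !u0 !mul0r !mulr0.
Qed.

Lemma circ_to_reduced : satisfies_sg_identity (circ mul) -> satisfies_reduced_sg_identity mul.
Proof.
move=> [u [v [u0 v0 uv H]]].
have polyE f : circ_poly (emb \o f) u = circ_poly (emb \o f) v.
  apply/subr0_eq; apply: (poly_eq0_of_evaluations K_inf tfU) => c.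
  rewrite hornerD hornerN !horner_circ_poly.
  have E w : w != [::] -> \prod_(i <- w) (1 + c *: emb (f i)) = 1 + emb (weval (circ mul) (fun i => c *: f i) w).
    by move=> w0; rewrite emb_weval_circ //; apply: eq_bigr => i _; rewrite embZ.
  by rewrite !E // H subrr.
(* For different lengths, the top coefficient of the longer product shows that the longer word
   vanishes on R. *)
have zero_word w w' : (size w' < size w)%N -> (forall f, circ_poly (emb \o f) w = circ_poly (emb \o f) w') ->
    satisfies_reduced_sg_identity mul.
  move=> lt E; apply: (@reduced_of_zero_word w) => f.
  by rewrite -(circ_poly_lead (emb \o f)) E circ_poly_coef_big.
case: (ltngtP (size u) (size v)) => [lt|lt|suv].
- by apply: zero_word lt _ => f; rewrite polyE.
- exact: zero_word lt polyE.
have [p [s [u' [v' [uE vE s' u'0 red]]]]] := reduced_core suv uv.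
have v'0 : v' != [::] by rewrite -size_eq0 -s' size_eq0.
exists u', v'; split=> //; split=> // [|f].
  by apply: contraTneq red => ->; rewrite /reduced_words eqxx.
apply: (@emb_inj _ _ _ Halg); rewrite !emb_weval //.
have : circ_poly (emb \o f) u' = circ_poly (emb \o f) v'.
  apply/subr0_eq; apply: (mul_eq0_const1r (circ_poly_coef0 (emb \o f) s)).
  apply: (mul_eq0_const1l (circ_poly_coef0 (emb \o f) p)).
  by rewrite mulrBl mulrBr -!circ_poly_cat -uE -vE polyE subrr.
by move/(congr1 (fun q : {poly U} => q`_(size u'))); rewrite {2}s' !circ_poly_lead.
Qed.

Lemma reduced_to_binomial : satisfies_reduced_sg_identity mul ->
  satisfies_reduced_binomial_identity mul.
Proof.
move=> [u [v [red [u0 v0 _ H]]]]; exists 1, (-1), u, v; split=> // [|f].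
  by rewrite oner_neq0.
by rewrite H scale1r scaleN1r subrr.
Qed.

Lemma emb_yxy x y i n : (i <= n)%N -> emb (xyeval mul x y (yxy_word i n)) =
  emb y ^+ i * emb x * emb y ^+ (n - i).
Proof.
move=> le_in; rewrite /xyeval emb_weval; last by rewrite /yxy_word; case: i le_in.
rewrite /yxy_word big_cat big_cons /= mulrA.
by congr (_ * _ * _); rewrite big_nseq -Monoid.iteropE.
Qed.

Definition yxy_identity := exists (n : nat) (a : nat -> K), [/\ a 0%N != 0, a n != 0 &
  forall x y : V, \sum_(i < n.+1) a i *: xyeval mul x y (yxy_word i n) = 0].

Lemma yxy_identityE n a x y : (\sum_(i < n.+1) a i *: xyeval mul x y (yxy_word i n) = 0) <->
  (\sum_(i < n.+1) a i *: (emb y ^+ i * emb x * emb y ^+ (n - i)) = 0).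
Proof.
have <- : emb (\sum_(i < n.+1) a i *: xyeval mul x y (yxy_word i n)) =
    \sum_(i < n.+1) a i *: (emb y ^+ i * emb x * emb y ^+ (n - i)).
  rewrite (big_morph emb (embD Halg) (emb0 Halg)); apply: eq_bigr => i _.
  by rewrite embZ emb_yxy // -ltnS.
by split=> [->|/emb_inj].
Qed.

(** x y^m + y^m x = 0 has nonzero end coefficients. *)
Lemma yxy_of_nil m : (0 < m)%N -> (forall y, emb y ^+ m = 0) -> yxy_identity.
Proof.
move=> m_gt0 H; exists m, (fun i => if (i == 0%N) || (i == m) then 1 else 0).
rewrite !eqxx orbT oner_neq0; split=> // x y; apply/yxy_identityE; apply: big1 => i _.
case: eqP => [->|_] /=; first by rewrite subn0 H mulr0 scaler0.
by case: eqP => [->|_]; rewrite ?H ?mul0r ?scaler0 // scale0r.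
Qed.

(** The value of w when y + c b_k x is substituted for the letter k, as a polynomial in c; the
    linearization is its coefficient of degree 1. *)
Definition lin_poly (b : nat -> K) (x y : U) (w : seq nat) : {poly U} :=
  \prod_(k <- w) (y%:P + (b k *: x)%:P * 'X).

Lemma horner_lin_poly b x y w (c : K) :
  (lin_poly b x y w).[c%:A] = \prod_(k <- w) (y + (c * b k) *: x).
Proof.
elim: w => [|k w IHw]; first by rewrite /lin_poly !big_nil hornerC.
rewrite /lin_poly !big_cons hornerM_comm; last exact: comm_poly_alg.
by rewrite IHw hornerD hornerMX !hornerC mulr_algr scalerA.
Qed.

Lemma lin_poly_coef0 b x y w : (lin_poly b x y w)`_0 = y ^+ size w.
Proof.
elim: w => [|k w IHw]; first by rewrite /lin_poly big_nil coef1.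
rewrite /lin_poly big_cons mulrDl coefD coefCM -mulrA coefCM coefXM /= mulr0 addr0.
by rewrite IHw exprS.
Qed.

Lemma lin_poly_coef1 b x y w : (lin_poly b x y w)`_1 =
  \sum_(i < size w) b (nth 0%N w i) *: (y ^+ i * x * y ^+ ((size w).-1 - i)).
Proof.
elim: w => [|k w IHw]; first by rewrite /lin_poly big_nil coef1 big_ord0.
rewrite /lin_poly big_cons mulrDl coefD coefCM -mulrA coefCM coefXM /= -/(lin_poly b x y w).
rewrite IHw lin_poly_coef0 big_ord_recl /= subn0 expr0 mul1r -scalerAl addrC; congr (_ + _).
rewrite mulr_sumr; apply: eq_bigr => i _; rewrite -scalerAr !mulrA -exprS /bump /= add1n.
by rewrite subnS predn_sub.
Qed.
Lemma binomial_to_yxy : satisfies_reduced_binomial_identity mul -> yxy_identity.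
Proof.
move=> [a1 [a2 [u1 [u2 [u10 u20 /andP[hd lt] nz H]]]]].
have HU (g : nat -> V) :
    a1 *: \prod_(i <- u1) emb (g i) + a2 *: \prod_(i <- u2) emb (g i) = 0.
  by rewrite -!emb_weval // -!embZ -embD H.
have const y : a1 *: emb y ^+ size u1 + a2 *: emb y ^+ size u2 = 0.
  have prod_const w : \prod_(i <- w) emb y = emb y ^+ size w :> U.
    by elim: w => [|k w IHw]; rewrite ?big_nil // big_cons IHw -exprS.
  by have := HU (fun=> y); rewrite !prod_const.
have nil w a : w != [::] :> seq nat -> a != 0 -> (forall y, a *: emb y ^+ size w = 0) -> yxy_identity.
  move=> w0 a0 wy; apply: (@yxy_of_nil (size w)); first by rewrite lt0n size_eq0.
  by move=> y; case: (tfU (wy y)) => // /eqP; rewrite (negPf a0).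
have [a10|a10] := eqVneq a1 0.
  apply: (nil u2 a2) => // [|y]; first by move: nz; rewrite a10 eqxx.
  by rewrite -[RHS](const y) a10 scale0r add0r.
have [a20|a20] := eqVneq a2 0.
  by apply: (nil u1 a1) => // y; rewrite -[RHS](const y) a20 scale0r addr0.
(* If the lengths differ, replacing y by c y separates the two monomials, and R is nil of bounded
   index. *)
have [suv|suv] := eqVneq (size u1) (size u2); last first.
  apply: (nil u1 a1) => // y.
  pose q : {poly U} := (a1 *: emb y ^+ size u1)%:P * 'X^(size u1) + (a2 *: emb y ^+ size u2)%:P * 'X^(size u2).
  have q0 : q = 0.
    apply: (poly_eq0_of_evaluations K_inf tfU) => c.
    rewrite hornerD !hornerM_comm; try exact: comm_poly_alg.
    rewrite !hornerXn !hornerC -[RHS](const (c *: y)) !embZ.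
    by rewrite !exprZn !expr1n !mulr_algr !scalerA ![c ^+ _ * _]mulrC.
  have := congr1 (fun q : {poly U} => q`_(size u1)) q0.
  by rewrite coef0 coefD !coefCM !coefXn eqxx (negPf suv) mulr1 mulr0 addr0.
have [n s1] : exists n, size u1 = n.+1 by case: (u1) u10 => // a w _; exists (size w).
have s2 : size u2 = n.+1 by rewrite -suv.
pose b1 := head 0%N u1; pose b2 := head 0%N u2; pose c1 := last 0%N u1; pose c2 := last 0%N u2.
(* The weights are 0 or 1, chosen so that at either end exactly one of a1, a2 survives. *)
have [b [bhd blt]] : exists b : nat -> K, a1 * b b1 + a2 * b b2 != 0 /\ a1 * b c1 + a2 * b c2 != 0.
  rewrite -/b1 -/b2 in hd; rewrite -/c1 -/c2 in lt.
  have [bc|bc] := eqVneq b2 c1.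
    exists (fun k => (k == b2)%:R); rewrite eqxx (negPf hd) -bc eqxx.
    by rewrite [c2 == b2]eq_sym bc (negPf lt) !mulr0 !mulr1 add0r addr0.
  have [bd|bd] := eqVneq b1 c2.
    exists (fun k => (k == b1)%:R); rewrite eqxx [b2 == _]eq_sym (negPf hd) bd eqxx.
    by rewrite (negPf lt) !mulr0 !mulr1 add0r addr0.
  exists (fun k => ((k == b1) || (k == c1))%:R); rewrite !eqxx orbT [b2 == _]eq_sym (negPf hd) (negPf bc).
  by rewrite [c2 == b1]eq_sym (negPf bd) [c2 == _]eq_sym (negPf lt) !mulr0 !mulr1 !addr0.
exists n, (fun i => a1 * b (nth 0%N u1 i) + a2 * b (nth 0%N u2 i)); split.
- by rewrite !nth0.
- by move: blt; rewrite /c1 /c2 -!nth_last s1 s2.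
move=> x y; apply/yxy_identityE.
pose q : {poly U} := (a1%:A)%:P * lin_poly b (emb x) (emb y) u1 + (a2%:A)%:P * lin_poly b (emb x) (emb y) u2.
have q0 : q = 0.
  apply: (poly_eq0_of_evaluations K_inf tfU) => c.
  rewrite hornerD !hornerM_comm; try exact: comm_poly_alg.
  rewrite !hornerC !horner_lin_poly !mulr_algl -[RHS](HU (fun k => y + (c * b k) *: x)).
  by congr (_ *: _ + _ *: _); apply: eq_bigr => k _; rewrite embD embZ.
have := congr1 (fun q : {poly U} => q`_1) q0.
rewrite coef0 coefD !coefCM !lin_poly_coef1 !mulr_algl s1 s2 /= => E.
rewrite -[RHS]E !scaler_sumr -big_split /=; apply: eq_bigr => i _.
by rewrite !scalerA scalerDl.
Qed.

(** * The action of K[s, t] by left and right multiplication *)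

Section Bimodule.
Variable y : U.
Local Notation E := {poly {poly K}}.

(* K[s, t] is {poly {poly K}} with s = ('X)%:P and t = 'X; since the value of a polynomial
   over U at y has its coefficients on the left, s acts as y * u and t as u * y. *)
Definition bact (P : E) (u : U) : U := (map_poly (horner_alg y) P * u%:P).[y].

(** The value of p q at y is the sum of the p_i q(y) y^i; this makes [bact] multiplicative. *)
Lemma horner_mul_right (p q : {poly U}) : (p * q).[y] = (p * (q.[y])%:P).[y].
Proof.
elim/poly_ind: p => [|p c IHp]; first by rewrite !mul0r.
rewrite !mulrDl !hornerD -!mulrA -!commr_polyX !mulrA !hornerMX IHp; congr (_ + _).
by rewrite !hornerCM hornerC.
Qed.

Lemma bactM P Q u : bact (P * Q) u = bact P (bact Q u).
Proof. by rewrite /bact rmorphM -mulrA horner_mul_right. Qed.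
Lemma bactD P Q u : bact (P + Q) u = bact P u + bact Q u.
Proof. by rewrite /bact rmorphD mulrDl hornerD. Qed.
Lemma bact0 u : bact 0 u = 0.
Proof. by rewrite /bact rmorph0 mul0r horner0. Qed.
Lemma bact1 u : bact 1 u = u.
Proof. by rewrite /bact rmorph1 mul1r hornerC. Qed.
Lemma bact_u0 P : bact P 0 = 0.
Proof. by rewrite /bact mulr0 horner0. Qed.
Lemma bactC (c : K) u : bact (c%:P)%:P u = c *: u.
Proof. by rewrite /bact map_polyC /= horner_algC -polyCM hornerC mulr_algl. Qed.
Lemma bact_s u : bact ('X)%:P u = y * u.
Proof. by rewrite /bact map_polyC /= horner_algX -polyCM hornerC. Qed.
Lemma bact_t u : bact 'X u = u * y.
Proof. by rewrite /bact map_polyX -commr_polyX hornerMX hornerC. Qed.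
Lemma bactX P k u : bact (P ^+ k) u = iter k (bact P) u.
Proof. by elim: k => [|k IHk]; rewrite ?expr0 ?bact1 // exprS bactM IHk. Qed.
Lemma bact_sum m (F : 'I_m -> E) u : bact (\sum_i F i) u = \sum_i bact (F i) u.
Proof. by rewrite (big_morph (fun P => bact P u) (fun P Q => bactD P Q u) (bact0 u)). Qed.
End Bimodule.

Lemma bact_sided (y z : U) (P Q : {poly {poly K}}) (al : nat -> K) n u :
    (forall v, bact y P v = z * v) -> (forall v, bact y Q v = v * z) ->
  bact y (\sum_(i < n.+1) ((al i)%:P)%:P * P ^+ i * Q ^+ (n - i)) u =
  \sum_(i < n.+1) al i *: (z ^+ i * u * z ^+ (n - i)).
Proof.
move=> HP HQ; rewrite bact_sum; apply: eq_bigr => i _; rewrite !bactM bactC !bactX.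
congr (_ *: _); rewrite -mulrA.
have -> k : iter k (bact y Q) u = u * z ^+ k.
  by elim: k => [|k IHk]; rewrite ?expr0 ?mulr1 // iterS IHk HQ exprSr mulrA.
move: (u * _) => v; elim: (i : nat) => [|k IHk]; first by rewrite mul1r.
by rewrite iterS IHk HP exprS mulrA.
Qed.

Lemma yxy_to_engel : yxy_identity ->
  exists n : nat, (1 <= n)%N /\ forall x y : V, engel mul n x y = 0.
Proof.
move=> [n [al [al0 aln H]]]; pose N := (n * n + n)%N.
(* The additional commutator keeps the exponent positive even for n = 0. *)
exists (N + N + n).+1; split=> // x y0; set y := emb y0.
(* The annihilator of R in K[s, t], an ideal that is saturated because R is torsion-free. *)
pose I (P : {poly {poly K}}) := forall u : V, bact y P (emb u) = 0.
have ID P Q : I P -> I Q -> I (P + Q) by move=> HP HQ u; rewrite bactD HP HQ addr0.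
have IM P Q : I Q -> I (P * Q) by move=> HQ u; rewrite bactM HQ bact_u0.
have IMr P Q : I P -> I (P * Q) by rewrite mulrC; exact: (IM).
have Isat (c : K) P : c != 0 -> I ((c%:P)%:P * P) -> I P.
  move=> c0 HP u; have := HP u; rewrite bactM bactC => /tfU[/eqP|//].
  by rewrite (negPf c0).
pose s : {poly {poly K}} := ('X)%:P; pose t : {poly {poly K}} := 'X.
pose aE i : {poly {poly K}} := ((al i)%:P)%:P.
have sided (z : V) P Q : (forall v, bact y P v = emb z * v) -> (forall v, bact y Q v = v * emb z) ->
    I (\sum_(i < n.+1) aE i * P ^+ i * Q ^+ (n - i)).
  by move=> HP HQ u; rewrite (bact_sided _ _ _ HP HQ); apply/yxy_identityE.
(* The element l y + y^2 acts on the left as l s + s^2 and on the right as l t + t^2. The c_j are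
   the coefficients in l of the resulting form, so interpolation puts them in I. *)
have [c cE] := homogeneous_coefs s (s ^+ 2) t (t ^+ 2) aE n.
have Ic j : (j < n.+1)%N -> I (c j).
  move=> jn u; move: j jn.
  apply: (coef_of_evaluations K_inf (P := fun u : U => u = 0)) => //.
  - by move=> a b -> ->; rewrite addr0.
  - by move=> a b ->; rewrite scaler0.
  - by move=> a b a0 /tfU[/eqP|//]; rewrite (negPf a0).
  move=> l; pose X : {poly {poly K}} := (l%:P)%:P.
  have := cE X 1; set S := \sum_(i < _) _ => SE.
  have IS : I S.
    apply: (sided (l *: y0 + mul y0 y0)) => v; rewrite embD embZ embM mulr1 bactD.
      by rewrite mulrC !bactM bactC !bact_s mulrDl mulrA -scalerAl.
    by rewrite mulrC !bactM bactC !bact_t mulrDr mulrA -scalerAr.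
  rewrite -[RHS](IS u) SE bact_sum; apply: eq_bigr => j _.
  by rewrite expr1n mulr1 mulrC /X -!rmorphXn bactM bactC.
pose d := t - s.
have Istd : I (s ^+ n * t ^+ n * d ^+ n).
  apply: (Isat _ _ aln).
  (* Cramer's rule amounts to taking X = t^2 and Y = -t: the second linear form becomes 0 and the
     first s t (t - s), so only the term i = n survives. *)
  have -> : ((al n)%:P)%:P * (s ^+ n * t ^+ n * d ^+ n) =
      \sum_(i < n.+1) aE i * (s * t ^+ 2 + s ^+ 2 * - t) ^+ i * (t * t ^+ 2 + t ^+ 2 * - t) ^+ (n - i).
    rewrite big_ord_recr big1 => [|i _]; rewrite /=.
      rewrite add0r subnn expr0 mulr1; congr (_ * _).
      by rewrite -!exprMn /d; congr (_ ^+ _); ring.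
    have -> : t * t ^+ 2 + t ^+ 2 * - t = 0 by ring.
    by rewrite expr0n subn_eq0 leqNgt ltn_ord mulr0.
  rewrite cE; elim/big_ind: _ => [u|//|j _]; first exact: bact0.
  by do 2!apply: (IMr); exact: Ic.
(* Modulo I, a A^n is -B w. Its n-th power turns a^n A^(n^2) into a multiple of B^n, and the
   remaining A^n d^n completes an element of I; hence N = n^2 + n. *)
have one_sided A B w (a : K) : a != 0 -> I ((a%:P)%:P * A ^+ n + B * w) ->
    I (A ^+ n * B ^+ n * d ^+ n) -> I (A ^+ N * d ^+ n).
  move=> a0 I1 I2; apply: (Isat (a ^+ n)); first by rewrite expf_neq0.
  have -> : ((a ^+ n)%:P)%:P * (A ^+ N * d ^+ n) =
      (((a%:P)%:P * A ^+ n) ^+ n - (- (B * w)) ^+ n) * (A ^+ n * d ^+ n) +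
      (- w) ^+ n * (A ^+ n * B ^+ n * d ^+ n).
    rewrite !rmorphXn /N exprD exprM -mulrN !exprMn /=; ring.
  apply: (ID); last exact: (IM).
  by apply: (IMr); rewrite subrXX opprK; apply: (IMr).
have It : I (t ^+ N * d ^+ n).
  apply: (one_sided t s (\sum_(i < n) aE i.+1 * s ^+ i * t ^+ (n - i.+1)) _ al0); last first.
    by rewrite [t ^+ n * _]mulrC.
  have := sided y0 s t (bact_s y) (bact_t y).
  rewrite big_ord_recl /= expr0 mulr1 subn0 mulr_sumr.
  congr (I (_ + _)); apply: eq_bigr => i _.
  by rewrite /bump /= add1n exprS; ring.
have Is : I (s ^+ N * d ^+ n).
  apply: (one_sided s t (\sum_(i < n) aE i * s ^+ i * t ^+ (n - i.+1)) _ aln) => //.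
  have := sided y0 s t (bact_s y) (bact_t y).
  rewrite big_ord_recr /= subnn expr0 mulr1 addrC mulr_sumr.
  congr (I (_ + _)); apply: eq_bigr => i _.
  by rewrite -(subnSK (ltn_ord i)) exprS; ring.
(* In each monomial of (t - s)^(2N) either s or t has exponent at least N. *)
have Id : I (d ^+ (N + N + n)).
  rewrite exprD {1}/d exprBn mulr_suml; elim/big_ind: _ => [u|//|i _]; first exact: bact0.
  rewrite mulrnAl -mulr_natl; apply: (IM).
  have [Ni|iN] := leqP N i.
    have -> : (-1) ^+ i * t ^+ (N + N - i) * s ^+ i * d ^+ n =
        ((-1) ^+ i * t ^+ (N + N - i) * s ^+ (i - N)) * (s ^+ N * d ^+ n).
      by have -> : s ^+ i = s ^+ (i - N) * s ^+ N by [rewrite -exprD subnK]; ring.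
    exact: (IM).
  have le : (N <= N + N - i)%N by lia.
  have -> : (-1) ^+ i * t ^+ (N + N - i) * s ^+ i * d ^+ n =
      ((-1) ^+ i * t ^+ (N + N - i - N) * s ^+ i) * (t ^+ N * d ^+ n).
    have -> : t ^+ (N + N - i) = t ^+ (N + N - i - N) * t ^+ N by rewrite -exprD subnK.
    by ring.
  exact: (IM).
apply: (@emb_inj _ _ _ Halg); rewrite emb0 -iter_ad_emb.
rewrite -[RHS](ad0 y) iterS -[in RHS](Id x) bactX; congr (ad y _); apply: eq_iter => u.
rewrite /d -scaleN1r bactD -mul_polyC bactM bact_t.
have -> : ((-1 : {poly K})%:P : {poly {poly K}}) = ((-1 : K)%:P)%:P by rewrite !polyCN.
by rewrite bactC bact_s scaleN1r.
Qed.

(** * Morse words and their values *)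

Lemma morse_wordsS n :
  morse_u n.+2 = morse_u n.+1 ++ morse_v n.+1 /\ morse_v n.+2 = morse_v n.+1 ++ morse_u n.+1.
Proof.
by rewrite /morse_u /morse_v /=; case: (morse_fg n) => f g /=; rewrite !filter_cat.
Qed.

Lemma morse_heads n : exists u v, morse_u n.+1 = 0%N :: u /\ morse_v n.+1 = 1%N :: v.
Proof.
elim: n => [|n [u [v [uE vE]]]]; first by exists [:: 1%N], [:: 0%N].
have [-> ->] := morse_wordsS n.
by rewrite uE vE /=; exists (u ++ 1%N :: v), (v ++ 0%N :: u).
Qed.

Lemma emb_morse x y n :
  1 + emb (xyeval (circ mul) x y (morse_u n.+1)) = (morse_pair (1 + emb x) (1 + emb y) n).1 /\
  1 + emb (xyeval (circ mul) x y (morse_v n.+1)) = (morse_pair (1 + emb x) (1 + emb y) n).2.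
Proof.
pose g k := 1 + emb (if k == 0%N then x else y).
suff [<- <-] : \prod_(i <- morse_u n.+1) g i = (morse_pair (1 + emb x) (1 + emb y) n).1 /\
    \prod_(i <- morse_v n.+1) g i = (morse_pair (1 + emb x) (1 + emb y) n).2.
  by have [u [v [uE vE]]] := morse_heads n; rewrite /xyeval !emb_weval_circ ?uE ?vE.
elim: n => [|n [IHu IHv]]; first by rewrite /= !big_cons big_nil !mulr1.
have [-> ->] := morse_wordsS n; rewrite !big_cat /= IHu IHv.
by case: (morse_pair _ _ n).
Qed.

Lemma engel_to_morse :
    (exists n : nat, (1 <= n)%N /\ forall x y : V, engel mul n x y = 0) ->
  exists n : nat, (1 <= n)%N /\ forall x y : V,
    xyeval (circ mul) x y (morse_u n) = xyeval (circ mul) x y (morse_v n).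
Proof.
move=> [n [n_gt0 /(engel_morse_pair Halg K_inf Htf n_gt0)[k kE]]].
exists k.+1; split=> // x y; apply: (@emb_inj _ _ _ Halg); apply: (addrI 1).
by have [-> ->] := emb_morse x y k.
Qed.

End Words.

(** Only the letters 0 and 1 occur in the Morse words, so arbitrary substitutions reduce to pairs;
    their different first letters make the identity nontrivial. *)
Lemma morse_to_circ (T : Type) (op : T -> T -> T) n : (1 <= n)%N ->
    (forall x y, xyeval op x y (morse_u n) = xyeval op x y (morse_v n)) ->
  satisfies_sg_identity op.
Proof.
case: n => // n _ H; exists (morse_u n.+1), (morse_v n.+1).
have lt2 w : all (fun k => k < 2)%N w -> forall f : nat -> T, weval op f w = xyeval op (f 0%N) (f 1%N) w.
  case: w => //= a w /andP[a2 w2] f; rewrite /xyeval /=.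
  have fE k : (k < 2)%N -> f k = if k == 0%N then f 0%N else f 1%N by case: k => [|[]].
  rewrite fE //; elim: w (if _ then _ else _) w2 => //= b w IHw z /andP[b2 w2].
  by rewrite IHw // [f b]fE.
have [u [v [uE vE]]] := morse_heads n; split.
- by rewrite uE.
- by rewrite vE.
- by rewrite uE vE.
by move=> f; rewrite !lt2 ?H // filter_all.
Qed.

Theorem theorem1p1 (K : idomainType) (V : lmodType K) (mul : V -> V -> V)
    (K_inf : infinite_type K) (Halg : nu_algebra mul) (Htf : torsion_free V) :
  [<-> satisfies_sg_identity (circ mul);
       satisfies_reduced_sg_identity mul;
       satisfies_reduced_binomial_identity mul;
       exists (n : nat) (a : nat -> K), [/\ a 0%N != 0, a n != 0 &
         forall x y : V,
           \sum_(i < n.+1) a i *: xyeval mul x y (yxy_word i n) = 0];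
       exists n : nat, (1 <= n)%N /\ forall x y : V, engel mul n x y = 0;
       exists n : nat, (1 <= n)%N /\ forall x y : V,
         xyeval (circ mul) x y (morse_u n) = xyeval (circ mul) x y (morse_v n)].
Proof.
tfae.
- exact: circ_to_reduced Halg K_inf Htf.
- exact: reduced_to_binomial.
- exact: binomial_to_yxy Halg K_inf Htf.
- exact: yxy_to_engel Halg K_inf Htf.
- exact: engel_to_morse Halg K_inf Htf.
- by move=> [n [n1 H]]; exact: morse_to_circ n1 H.
Qed.
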